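(* Let $n\ge 1$ and let $q\in\mathbb{C}^*\setminus\{1\}$. (i) Each of the algebras $A^{(t)}_n$ (over $R$) and $A^q_n$ (over $\mathbb{C}$) has an algebra endomorphism that is injective but not surjective. (ii) $A^q_n$ has a $\mathbb{C}$-algebra endomorphism that is neither injective nor surjective. (iii) Every $R$-algebra endomorphism of $A^{(t)}_n$, and every $R$-algebra endomorphism of $A^{(t)}_{n,\mathrm{f}}$, is injective.
   Context: Let $R=\mathbb{C}[t,t^{-1}]$. For $n\ge 1$ the quantized Weyl algebra is $A^{(t)}_n=R\langle x_1,\dots,x_n,\partial_1,\dots,\partial_n\rangle/I_t$, where $I_t$ is the two-sided ideal generated by $\partial_i x_j-t^{\delta_{ij}}x_j\partial_i-\delta_{ij}$, $x_ix_j-x_jx_i$ and $\partial_i\partial_j-\partial_j\partial_i$ for $1\le i,j\le n$. For $q\in\mathbb{C}^*$, $A^q_n=A^{(t)}_n/(t-q)$. Endomorphisms are unital algebra endomorphisms over the base ring ($R$ for $A^{(t)}_n$ and $A^{(t)}_{n,\mathrm{f}}$; $\mathbb{C}$ for $A^q_n$). Put $\mathrm{f}=\prod_{i=1}^n \mathrm{f}_i\in A^{(t)}_n$ with $\mathrm{f}_i=[\partial_i,x_i]=\partial_ix_i-x_i\partial_i=1-(1-t)x_i\partial_i$. The set $\{\mathrm{f}^k: k\ge 0\}$ is an Ore set in $A^{(t)}_n$, and $A^{(t)}_{n,\mathrm{f}}$ denotes the corresponding Ore localization (obtained by inverting $\mathrm{f}$). *)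

(* Defs.v *)
From HB Require Import structures.
From mathcomp Require Import all_boot all_order all_algebra.
From mathcomp Require Import zify boolp reals.
From mathcomp Require Import finmap monalg.
From mathcomp.real_closed Require Import complex.

Set Implicit Arguments.
Unset Strict Implicit.
Unset Printing Implicit Defensive.

Import Order.TTheory GRing.Theory.
Local Open Scope ring_scope.
Local Open Scope quotient_scope.

(* Associative unital R-algebras, given by a ring A and a ring morphism from  *)
(* R to the center of A.  Unlike in algType R, the zero ring is allowed, so   *)
(* that quotients and localizations are algebras without side conditions.     *)
HB.mixin Record isPzAlgebra (R : comPzRingType) A of GRing.PzRing A := {
  structm : R -> A;
  structm_zmod : zmod_morphism structm;
  structm_monoid : monoid_morphism structm;
  structm_central : forall c a, structm c * a = a * structm c
}.

#[short(type="pzAlgType")]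
HB.structure Definition PzAlgebra (R : comPzRingType) :=
  {A of GRing.PzRing A & isPzAlgebra R A}.

HB.instance Definition _ (R : comPzRingType) (A : pzAlgType R) :=
  GRing.isZmodMorphism.Build R A (@structm R A) structm_zmod.
HB.instance Definition _ (R : comPzRingType) (A : pzAlgType R) :=
  GRing.isMonoidMorphism.Build R A (@structm R A) structm_monoid.

Definition alg_hom (R : comPzRingType) (A B : pzAlgType R) (h : A -> B) :=
  [/\ zmod_morphism h, monoid_morphism h
    & forall c : R, h (structm c) = structm c].

Definition alg_endo (R : comPzRingType) (A : pzAlgType R) (h : A -> A) :=
  alg_hom h.
Arguments alg_endo : clear implicits.

Definition surjective (A B : Type) (h : A -> B) : Prop :=
  forall b, exists a, h a = b.

Section AlgHom.
Context (R : comPzRingType) (A B : pzAlgType R) (h : A -> B).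
Hypothesis hh : alg_hom h.

Lemma alg_homB a b : h (a - b) = h a - h b. Proof. by case: hh. Qed.

Lemma alg_hom0 : h 0 = 0.
Proof. by rewrite -(subrr 0) alg_homB subrr. Qed.

Lemma alg_homN a : h (- a) = - h a.
Proof. by rewrite -[- a]sub0r alg_homB alg_hom0 sub0r. Qed.

Lemma alg_homD a b : h (a + b) = h a + h b.
Proof. by rewrite -[b in LHS]opprK alg_homB alg_homN opprK. Qed.

Lemma alg_hom1 : h 1 = 1. Proof. by case: hh => _ []. Qed.

Lemma alg_homM a b : h (a * b) = h a * h b. Proof. by case: hh => _ []. Qed.

Lemma alg_homC c : h (structm c) = structm c. Proof. by case: hh. Qed.

Lemma alg_homX a k : h (a ^+ k) = h a ^+ k.
Proof.
by elim: k => [|k IHk]; rewrite ?expr0 ?alg_hom1 // !exprS alg_homM IHk.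
Qed.

Lemma alg_hom_prod (T : Type) (r : seq T) (G : T -> A) :
  h (\prod_(j <- r) G j) = \prod_(j <- r) h (G j).
Proof. exact: (big_morph _ alg_homM alg_hom1). Qed.

End AlgHom.

Lemma alg_hom_comp (R : comPzRingType) (A B C : pzAlgType R)
    (g : B -> C) (h : A -> B) : alg_hom g -> alg_hom h -> alg_hom (g \o h).
Proof.
move=> hg hh; split=> [a b||c] /=.
- by rewrite (alg_homB hh) (alg_homB hg).
- split=> [|a b] /=; first by rewrite (alg_hom1 hh) (alg_hom1 hg).
  by rewrite (alg_homM hh) (alg_homM hg).
- by rewrite (alg_homC hh) (alg_homC hg).
Qed.

Lemma alg_hom_id (R : comPzRingType) (A : pzAlgType R) : alg_hom (@id A).
Proof. by []. Qed.

(* ------------------------------------------------------------------------ *)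

Section TwoSidedIdeal.
Context (R : comPzRingType) (A : pzAlgType R) (S : A -> Prop).

(* the two-sided ideal generated by S *)
Inductive gen_ideal : A -> Prop :=
| gen_ideal_in a of S a : gen_ideal a
| gen_ideal0 : gen_ideal 0
| gen_idealD a b of gen_ideal a & gen_ideal b : gen_ideal (a + b)
| gen_idealM a b c of gen_ideal b : gen_ideal (a * b * c).

Definition ideal_pred : {pred A} := fun a => `[< gen_ideal a >].

Lemma ideal_predP a : reflect (gen_ideal a) (a \in ideal_pred).
Proof. exact: asboolP. Qed.

Lemma ideal_zmod_closed : zmod_closed ideal_pred.
Proof.
split=> [|a b /ideal_predP Ia /ideal_predP Ib]; apply/ideal_predP.
  exact: gen_ideal0.
apply: gen_idealD => //; rewrite -[- b]mulN1r -[_ * b]mulr1.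
exact: gen_idealM.
Qed.

HB.instance Definition _ :=
  GRing.isZmodClosed.Build A ideal_pred ideal_zmod_closed.

Definition quot_alg := Quotient.quot ideal_pred.

HB.instance Definition _ : EqQuotient A (Quotient.equiv ideal_pred) quot_alg :=
  EqQuotient.on quot_alg.
HB.instance Definition _ := GRing.Zmodule.on quot_alg.

Definition quot_pi (a : A) : quot_alg := \pi_quot_alg a.

Lemma quot_piP a b : quot_pi a = quot_pi b <-> gen_ideal (a - b).
Proof.
have E := Quotient.idealrBE ideal_pred a b.
split=> [/eqP|]; first by rewrite -E => /ideal_predP.
by move=> /ideal_predP; rewrite E => /eqP.
Qed.

Lemma quot_piK (x : quot_alg) : quot_pi (repr x) = x.
Proof. exact: reprK. Qed.

Lemma quot_pi_surj : surjective quot_pi.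
Proof. by move=> x; exists (repr x); exact: quot_piK. Qed.

Lemma quot_piB a b : quot_pi (a - b) = quot_pi a - quot_pi b.
Proof. exact: (raddfB (\pi_(Quotient.quot ideal_pred))). Qed.

Lemma quot_piD a b : quot_pi (a + b) = quot_pi a + quot_pi b.
Proof. exact: (raddfD (\pi_(Quotient.quot ideal_pred))). Qed.

End TwoSidedIdeal.

(* The products below are sealed: comparing two of them by unfolding does not *)
(* terminate in practice.                                                     *)
HB.lock Definition quot_mul (R : comPzRingType) (A : pzAlgType R)
    (S : A -> Prop) (x y : quot_alg S) : quot_alg S :=
  quot_pi S (repr x * repr y).

Section QuotientAlgebra.
Context (R : comPzRingType) (A : pzAlgType R) (S : A -> Prop).
Local Notation quot_alg := (quot_alg S).
Local Notation quot_pi := (quot_pi S).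
Local Notation gen_ideal := (gen_ideal S).

Lemma quot_repr a : gen_ideal (repr (quot_pi a) - a).
Proof. by apply/quot_piP; rewrite quot_piK. Qed.

Lemma quot_mulE a b : quot_mul (quot_pi a) (quot_pi b) = quot_pi (a * b).
Proof.
rewrite unlock; apply/quot_piP; set a' := repr _; set b' := repr _.
have -> : a' * b' - a * b = 1 * (a' - a) * b' + a * (b' - b) * 1.
  by rewrite mul1r mulr1 mulrBl mulrBr addrA subrK.
by apply: gen_idealD; apply: gen_idealM; apply: quot_repr.
Qed.

Lemma quot_ind (P : quot_alg -> Prop) :
  (forall a, P (quot_pi a)) -> forall x, P x.
Proof. by move=> PP x; rewrite -[x]quot_piK. Qed.

Fact quot_mulA : associative (@quot_mul R A S).
Proof.
elim/quot_ind=> a; elim/quot_ind=> b; elim/quot_ind=> c.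
by rewrite !quot_mulE mulrA.
Qed.
Fact quot_mul1 : left_id (quot_pi 1) (@quot_mul R A S).
Proof. by elim/quot_ind=> a; rewrite quot_mulE mul1r. Qed.
Fact quot_mulr1 : right_id (quot_pi 1) (@quot_mul R A S).
Proof. by elim/quot_ind=> a; rewrite quot_mulE mulr1. Qed.
Fact quot_mulDl : left_distributive (@quot_mul R A S) +%R.
Proof.
elim/quot_ind=> a; elim/quot_ind=> b; elim/quot_ind=> c.
by rewrite -quot_piD !quot_mulE mulrDl quot_piD.
Qed.
Fact quot_mulDr : right_distributive (@quot_mul R A S) +%R.
Proof.
elim/quot_ind=> a; elim/quot_ind=> b; elim/quot_ind=> c.
by rewrite -quot_piD !quot_mulE mulrDr quot_piD.
Qed.

HB.instance Definition _ := GRing.Zmodule_isPzRing.Build quot_alg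
  quot_mulA quot_mul1 quot_mulr1 quot_mulDl quot_mulDr.

Lemma quot_piM a b : quot_pi (a * b) = quot_pi a * quot_pi b.
Proof. by rewrite -quot_mulE. Qed.

Definition quot_structm (c : R) : quot_alg := quot_pi (structm c).

Fact quot_structm_zmod : zmod_morphism quot_structm.
Proof. by move=> c d; rewrite /quot_structm rmorphB quot_piB. Qed.
Fact quot_structm_monoid : monoid_morphism quot_structm.
Proof.
by split=> [|c d]; rewrite /quot_structm ?rmorph1 // rmorphM quot_piM.
Qed.
Fact quot_structm_central c x : quot_structm c * x = x * quot_structm c.
Proof. by elim/quot_ind: x => a; rewrite -!quot_piM structm_central. Qed.

HB.instance Definition _ := isPzAlgebra.Build R quot_alg
  quot_structm_zmod quot_structm_monoid quot_structm_central.

Lemma quot_pi_hom : alg_hom quot_pi.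
Proof.
split=> //; first exact: quot_piB.
by split=> // a b; exact: quot_piM.
Qed.

Lemma quot_pi_eq0 a : S a -> quot_pi a = 0.
Proof.
move=> Sa; rewrite -(alg_hom0 quot_pi_hom); apply/quot_piP.
by rewrite subr0; apply: gen_ideal_in.
Qed.

Section QuotLift.
Context (B : pzAlgType R) (h : A -> B).
Hypotheses (hh : alg_hom h) (hS : forall a, S a -> h a = 0).

Definition quot_lift (x : quot_alg) : B := h (repr x).

Lemma quot_liftE a : quot_lift (quot_pi a) = h a.
Proof.
apply/eqP; rewrite -subr_eq0 -(alg_homB hh); apply/eqP.
elim: (quot_repr a) => {a} [a /hS //||a b _ ha _ hb|a b c _ hb].
- exact: alg_hom0.
- by rewrite (alg_homD hh) ha hb addr0.
- by rewrite !(alg_homM hh) hb mulr0 mul0r.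
Qed.

Lemma quot_lift_hom : alg_hom quot_lift.
Proof.
split=> [||c].
- elim/quot_ind=> a; elim/quot_ind=> b.
  by rewrite -quot_piB !quot_liftE (alg_homB hh).
- split=> [|]; first by rewrite quot_liftE (alg_hom1 hh).
  elim/quot_ind=> a; elim/quot_ind=> b.
  by rewrite -quot_piM !quot_liftE (alg_homM hh).
- by rewrite quot_liftE (alg_homC hh).
Qed.

End QuotLift.
End QuotientAlgebra.

(* ------------------------------------------------------------------------ *)

(* A seen as an algebra over k along h : k -> R *)
Definition restrict_scalars (k R : comPzRingType) (h : {rmorphism k -> R})
  (A : pzAlgType R) : Type := A.

Section Restrict.
Context (k R : comPzRingType) (h : {rmorphism k -> R}) (A : pzAlgType R).
Local Notation restrict_scalars := (restrict_scalars h A).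

HB.instance Definition _ := GRing.PzRing.on restrict_scalars.

Definition restrict_structm (c : k) : restrict_scalars := @structm R A (h c).

Fact restrict_structm_zmod : zmod_morphism restrict_structm.
Proof. by move=> c d; rewrite /restrict_structm !rmorphB. Qed.
Fact restrict_structm_monoid : monoid_morphism restrict_structm.
Proof.
by split=> [|c d]; rewrite /restrict_structm ?rmorph1 // !rmorphM.
Qed.
Fact restrict_structm_central c a :
  restrict_structm c * a = a * restrict_structm c.
Proof. exact: (@structm_central R A). Qed.

HB.instance Definition _ := isPzAlgebra.Build k restrict_scalars
  restrict_structm_zmod restrict_structm_monoid restrict_structm_central.

End Restrict.

(* ------------------------------------------------------------------------ *)

(* the free algebra R<I> *)
Definition free_alg (R : comNzRingType) (I : choiceType) : Type :=
  {malg R[{fmonom I}]}.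

HB.lock Definition free_mul (R : comNzRingType) (I : choiceType)
    (a b : free_alg R I) : free_alg R I :=
  (a : {malg R[{fmonom I}]}) * (b : {malg R[{fmonom I}]}).

HB.lock Definition free_structm (R : comNzRingType) (I : choiceType) (c : R) :
    free_alg R I :=
  (c%:MP : {malg R[{fmonom I}]}).

HB.lock Definition free_gen (R : comNzRingType) (I : choiceType) (i : I) :
    free_alg R I :=
  (<< fmu i >> : {malg R[{fmonom I}]}).

Section FreeAlgebra.
Context (R : comNzRingType) (I : choiceType).
Local Notation F := (free_alg R I).
Local Notation free_gen := (free_gen R).
Local Notation free_structm := (free_structm I).

HB.instance Definition _ := GRing.Zmodule.on F.

Lemma free_mulE (a b : F) :
  free_mul a b = (a : {malg R[{fmonom I}]}) * (b : {malg R[{fmonom I}]}).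
Proof. by rewrite unlock. Qed.

Fact free_mulA : associative (@free_mul R I).
Proof. move=> a b c. rewrite !free_mulE. apply: (@mulrA {malg R[{fmonom I}]}). Qed.
Fact free_mul1 : left_id (1 : {malg R[{fmonom I}]}) (@free_mul R I).
Proof. move=> a. rewrite !free_mulE. apply: (@mul1r {malg R[{fmonom I}]}). Qed.
Fact free_mulr1 : right_id (1 : {malg R[{fmonom I}]}) (@free_mul R I).
Proof. move=> a. rewrite !free_mulE. apply: (@mulr1 {malg R[{fmonom I}]}). Qed.
Fact free_mulDl : left_distributive (@free_mul R I) +%R.
Proof. move=> a b c. rewrite !free_mulE. apply: (@mulrDl {malg R[{fmonom I}]}). Qed.
Fact free_mulDr : right_distributive (@free_mul R I) +%R.
Proof. move=> a b c. rewrite !free_mulE. apply: (@mulrDr {malg R[{fmonom I}]}). Qed.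

HB.instance Definition _ := GRing.Zmodule_isPzRing.Build F
  free_mulA free_mul1 free_mulr1 free_mulDl free_mulDr.

Lemma free_mulUU (c d : R) (u v : {fmonom I}) :
  (<< c *g u >> : F) * << d *g v >> = << c * d *g mmul u v >>.
Proof.
rewrite [LHS]free_mulE.
rewrite (malgMEw (msuppU_le (k := u) (x := c)) (msuppU_le (k := v) (x := d))).
by rewrite !big_seq_fset1 !mcoeffUU.
Qed.

Lemma free_structmE c : free_structm c = << c *g mone >> :> F.
Proof. by rewrite unlock. Qed.

Lemma free_genE i : free_gen i = << fmu i >> :> F.
Proof. by rewrite unlock. Qed.

Fact free_structm_zmod : zmod_morphism free_structm.
Proof. by move=> c d; rewrite !free_structmE [LHS]monalgUB. Qed.
Fact free_structm_monoid : monoid_morphism free_structm.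
Proof. by split=> [|c d]; rewrite !free_structmE // free_mulUU mul1m. Qed.
Fact free_structm_central c a : free_structm c * a = a * free_structm c.
Proof.
rewrite free_structmE [a]monalgE mulr_sumr mulr_suml.
apply: eq_bigr => u _; by rewrite !free_mulUU mul1m mulm1 mulrC.
Qed.

HB.instance Definition _ := isPzAlgebra.Build R F
  free_structm_zmod free_structm_monoid free_structm_central.

Lemma free_ind (P : F -> Prop) :
    (forall a b, P a -> P b -> P (a + b)) -> (forall c, P (structm c)) ->
    (forall i a, P a -> P (free_gen i * a)) ->
  forall a, P a.
Proof.
move=> PD PC Pgen a; rewrite [a]monalgE.
apply: big_ind => [|//|u _]; first by have := PC 0; rewrite rmorph0.
case: u => s; move: (a@_ _) => c; elim: s => [|i s IHs].
  suff -> : (<< c *g FMonom [::] >> : F) = structm c by [].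
  rewrite [RHS]free_structmE; congr << _ *g _ >>; apply/val_inj.
  by rewrite /= fm1.
suff -> : (<< c *g FMonom (i :: s) >> : F) = free_gen i * << c *g FMonom s >>.
  exact: Pgen.
rewrite free_genE free_mulUU mul1r; congr << _ *g _ >>; apply/val_inj.
by rewrite /= fmM fmU.
Qed.

Section Lift.
Context (B : pzAlgType R) (v : I -> B).

Definition free_lift (a : F) : B :=
  \sum_(u <- msupp a) structm a@_u * \prod_(i <- (u : seq I)) v i.

Lemma free_lift_supp (d : {fset {fmonom I}}) a : (msupp a `<=` d)%fset ->
  free_lift a = \sum_(u <- d) structm a@_u * \prod_(i <- (u : seq I)) v i.
Proof.
move=> le_d; apply: big_fset_incl => // u _ /mcoeff_outdom ->.
by rewrite rmorph0 mul0r.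
Qed.

Lemma free_liftU c (u : {fmonom I}) :
  free_lift << c *g u >> = structm c * \prod_(i <- (u : seq I)) v i.
Proof. by rewrite (free_lift_supp msuppU_le) big_seq_fset1 mcoeffUU. Qed.

Lemma free_liftB : zmod_morphism free_lift.
Proof.
move=> a b; pose d := (msupp a `|` msupp b)%fset.
rewrite (@free_lift_supp d (a - b)) ?msuppB_le //.
rewrite (@free_lift_supp d a) ?fsubsetUl // (@free_lift_supp d b) ?fsubsetUr //.
rewrite -sumrB; apply: eq_bigr => u _ /=.
by rewrite mcoeffB rmorphB mulrBl.
Qed.

HB.instance Definition _ := GRing.isZmodMorphism.Build F B free_lift free_liftB.

Lemma free_lift_gen i : free_lift (free_gen i) = v i.
Proof. by rewrite free_genE free_liftU fmU big_seq1 rmorph1 mul1r. Qed.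

Lemma free_lift_hom : alg_hom free_lift.
Proof.
have hC c : free_lift (structm c) = structm c.
  by rewrite [structm _]free_structmE free_liftU fm1 big_nil mulr1.
split=> //; first exact: free_liftB.
split=> [|a b]; first by rewrite -(rmorph1 (@structm R F)) hC rmorph1.
rewrite [a]monalgE [b]monalgE mulr_suml !raddf_sum mulr_suml.
apply: eq_bigr => u _; rewrite mulr_sumr !raddf_sum mulr_sumr.
apply: eq_bigr => w _; rewrite /= free_mulUU !free_liftU fmM big_cat /= rmorphM.
by rewrite -!mulrA; congr (_ * _); rewrite !mulrA structm_central.
Qed.

End Lift.
End FreeAlgebra.

(* ------------------------------------------------------------------------ *)

(* an element f such that a f = f tau(a) for an algebra endomorphism tau      *)
(* fixing f, so that the powers of f satisfy the right Ore condition          *)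
Record ore_elt (R : comPzRingType) (A : pzAlgType R) := OreElt {
  oelt :> A;
  otau : A -> A;
  otau_hom : alg_hom otau;
  otau_oelt : otau oelt = oelt;
  oeltE : forall a, a * oelt = oelt * otau a
}.

Section OreLocalization.
Context (R : comPzRingType) (A : pzAlgType R) (f : ore_elt A).

Local Notation tau k := (iter k (otau f)).

Lemma otau_iter_hom k : alg_hom (tau k).
Proof.
elim: k => [|k IHk]; first exact: alg_hom_id.
exact: (alg_hom_comp (otau_hom f) IHk).
Qed.

Lemma otau_iterX k l : tau k (oelt f ^+ l) = oelt f ^+ l.
Proof.
rewrite (alg_homX (otau_iter_hom k)); congr (_ ^+ _).
by elim: k => //= k ->; exact: otau_oelt.
Qed.

Lemma oelt_expE k a : a * oelt f ^+ k = oelt f ^+ k * tau k a.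
Proof.
elim: k a => [|k IHk] a; first by rewrite mulr1 mul1r.
by rewrite exprSr mulrA IHk -mulrA oeltE mulrA.
Qed.

(* the pair (a, k) stands for the right fraction a f^-k *)
Definition ore_equiv (x y : A * nat) : bool :=
  `[< exists m, x.1 * oelt f ^+ (y.2 + m) = y.1 * oelt f ^+ (x.2 + m) >].

Lemma ore_equivP (x y : A * nat) :
  reflect (exists m, x.1 * oelt f ^+ (y.2 + m) = y.1 * oelt f ^+ (x.2 + m))
          (ore_equiv x y).
Proof. exact: asboolP. Qed.

Fact ore_equiv_is_equiv : equiv_class_of ore_equiv.
Proof.
split=> [x|x y|y x z]; first by apply/ore_equivP; exists 0%N.
  by apply/ore_equivP/ore_equivP => -[m e]; exists m.
move=> /ore_equivP[m e] /ore_equivP[p e']; apply/ore_equivP.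
exists (y.2 + m + p)%N.
have -> : (z.2 + (y.2 + m + p) = y.2 + m + (z.2 + p))%N by lia.
rewrite exprD mulrA e -mulrA -exprD.
have -> : (x.2 + m + (z.2 + p) = z.2 + p + (x.2 + m))%N by lia.
rewrite exprD mulrA e' -mulrA -exprD; congr (_ * _ ^+ _); lia.
Qed.

Canonical ore_equiv_equiv := EquivRelPack ore_equiv_is_equiv.
Canonical ore_equiv_encModRel := defaultEncModRel ore_equiv.

Definition ore_loc := {eq_quot ore_equiv}.

HB.instance Definition _ : EqQuotient (A * nat)%type ore_equiv ore_loc :=
  EqQuotient.on ore_loc.
HB.instance Definition _ := Choice.on ore_loc.

Definition ore_frac (a : A) (k : nat) : ore_loc := \pi_ore_loc (a, k).

Lemma ore_fracP a k b l : ore_frac a k = ore_frac b l <->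
  exists m, a * oelt f ^+ (l + m) = b * oelt f ^+ (k + m).
Proof.
split=> [/eqmodP/ore_equivP //|H].
by apply/eqmodP/ore_equivP.
Qed.

Lemma ore_frac_ind (P : ore_loc -> Prop) :
  (forall a k, P (ore_frac a k)) -> forall x, P x.
Proof. by move=> PP x; rewrite -[x]reprK; case: (repr x). Qed.

Lemma ore_frac_repr a k :
  ore_frac (repr (ore_frac a k)).1 (repr (ore_frac a k)).2 = ore_frac a k.
Proof. by rewrite {3}/ore_frac -[RHS]reprK /ore_frac -surjective_pairing. Qed.

Definition ore_add (x y : ore_loc) : ore_loc :=
  let (a, k) := repr x in let (b, l) := repr y in
  ore_frac (a * oelt f ^+ l + b * oelt f ^+ k) (k + l)%N.
Definition ore_opp (x : ore_loc) : ore_loc :=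
  let (a, k) := repr x in ore_frac (- a) k.
(* f^-k b = tau^k(b) f^-k *)
Definition ore_mul (x y : ore_loc) : ore_loc :=
  let (a, k) := repr x in let (b, l) := repr y in
  ore_frac (a * tau k b) (k + l)%N.

Lemma ore_fracXr a k m : ore_frac (a * oelt f ^+ m) (k + m)%N = ore_frac a k.
Proof. by apply/ore_fracP; exists 0%N; rewrite -mulrA -exprD !addn0 addnC. Qed.

Lemma ore_addE a k b l : ore_add (ore_frac a k) (ore_frac b l) =
  ore_frac (a * oelt f ^+ l + b * oelt f ^+ k) (k + l)%N.
Proof.
have := ore_frac_repr b l; have := ore_frac_repr a k; rewrite /ore_add.
case: (repr _) => a' k'; case: (repr _) => b' l' /=.
move=> /ore_fracP[m ea] /ore_fracP[p eb]; apply/ore_fracP; exists (m + p)%N.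
rewrite !mulrDl -!mulrA -!exprD; congr (_ + _).
  have -> : (l' + (k + l + (m + p)) = k + m + (l' + l + p))%N by lia.
  rewrite exprD mulrA ea -mulrA -exprD; congr (_ * _ ^+ _); lia.
have -> : (k' + (k + l + (m + p)) = l + p + (k' + k + m))%N by lia.
rewrite exprD mulrA eb -mulrA -exprD; congr (_ * _ ^+ _); lia.
Qed.

Lemma ore_oppE a k : ore_opp (ore_frac a k) = ore_frac (- a) k.
Proof.
have := ore_frac_repr a k; rewrite /ore_opp; case: (repr _) => a' k' /=.
move=> /ore_fracP[m ea]; apply/ore_fracP; exists m.
by rewrite !mulNr ea.
Qed.

Lemma ore_mulE a k b l :
  ore_mul (ore_frac a k) (ore_frac b l) = ore_frac (a * tau k b) (k + l)%N.
Proof.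
have := ore_frac_repr b l; have := ore_frac_repr a k; rewrite /ore_mul.
case: (repr _) => a' k'; case: (repr _) => b' l' /=.
move=> /ore_fracP[m ea] /ore_fracP[p eb].
apply/ore_fracP; exists (m + p)%N.
have swap j c d i : d * tau j c * oelt f ^+ i = d * oelt f ^+ i * tau (i + j) c.
  by rewrite iterD -!mulrA -oelt_expE.
have -> : (k + l + (m + p) = k + m + (l + p))%N by lia.
rewrite exprD mulrA swap ea.
have -> : (k + m + k' = k' + m + k)%N by lia.
rewrite -swap -mulrA -exprD addnC exprD mulrA -[X in X * _]mulrA.
rewrite -(otau_iterX k) -(alg_homM (otau_iter_hom k)) eb.
rewrite (alg_homM (otau_iter_hom k)) otau_iterX mulrA -mulrA -exprD.
congr (_ * _ ^+ _); lia.
Qed.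

Fact ore_addA : associative ore_add.
Proof.
elim/ore_frac_ind=> a k; elim/ore_frac_ind=> b l; elim/ore_frac_ind=> c m.
rewrite !ore_addE !mulrDl -!mulrA -!exprD addrA [(l + k)%N]addnC [(m + k)%N]addnC.
by rewrite addnA.
Qed.

Fact ore_addC : commutative ore_add.
Proof.
elim/ore_frac_ind=> a k; elim/ore_frac_ind=> b l.
by rewrite !ore_addE addrC addnC.
Qed.

Fact ore_add0 : left_id (ore_frac 0 0) ore_add.
Proof. by elim/ore_frac_ind=> a k; rewrite ore_addE mul0r add0r mulr1. Qed.

Lemma ore_frac0 k : ore_frac 0 k = ore_frac 0 0.
Proof. by apply/ore_fracP; exists 0%N; rewrite !mul0r. Qed.

Fact ore_addN : left_inverse (ore_frac 0 0) ore_opp ore_add.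
Proof.
by elim/ore_frac_ind=> a k; rewrite ore_oppE ore_addE mulNr addNr ore_frac0.
Qed.

HB.instance Definition _ := GRing.isZmodule.Build ore_loc
  ore_addA ore_addC ore_add0 ore_addN.

Lemma ore_fracD a b k : ore_frac a k + ore_frac b k = ore_frac (a + b) k.
Proof. by rewrite [LHS]ore_addE -mulrDl ore_fracXr. Qed.

Lemma ore_fracN a k : - ore_frac a k = ore_frac (- a) k.
Proof. exact: ore_oppE. Qed.

Lemma ore_frac_common x y : exists a b k, x = ore_frac a k /\ y = ore_frac b k.
Proof.
elim/ore_frac_ind: x => a k; elim/ore_frac_ind: y => b l.
exists (a * oelt f ^+ l), (b * oelt f ^+ k), (k + l)%N.
by split; [rewrite ore_fracXr | rewrite addnC ore_fracXr].
Qed.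

Fact ore_mulA : associative ore_mul.
Proof.
elim/ore_frac_ind=> a k; elim/ore_frac_ind=> b l; elim/ore_frac_ind=> c m.
by rewrite !ore_mulE (alg_homM (otau_iter_hom k)) iterD mulrA addnA.
Qed.

Fact ore_mul1 : left_id (ore_frac 1 0) ore_mul.
Proof. by elim/ore_frac_ind=> a k; rewrite ore_mulE mul1r. Qed.

Fact ore_mulr1 : right_id (ore_frac 1 0) ore_mul.
Proof.
elim/ore_frac_ind=> a k.
by rewrite ore_mulE (alg_hom1 (otau_iter_hom k)) mulr1 addn0.
Qed.

Fact ore_mulDl : left_distributive ore_mul +%R.
Proof.
move=> x y; elim/ore_frac_ind=> c l.
have [a [b [k [-> ->]]]] := ore_frac_common x y.
by rewrite ore_fracD !ore_mulE ore_fracD mulrDl.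
Qed.

Fact ore_mulDr : right_distributive ore_mul +%R.
Proof.
elim/ore_frac_ind=> c l x y; have [a [b [k [-> ->]]]] := ore_frac_common x y.
by rewrite ore_fracD !ore_mulE ore_fracD (alg_homD (otau_iter_hom l)) mulrDr.
Qed.

HB.instance Definition _ := GRing.Zmodule_isPzRing.Build ore_loc
  ore_mulA ore_mul1 ore_mulr1 ore_mulDl ore_mulDr.

Lemma ore_fracM a k b l :
  ore_frac a k * ore_frac b l = ore_frac (a * tau k b) (k + l)%N.
Proof. exact: ore_mulE. Qed.

Definition ore_structm (c : R) : ore_loc := ore_frac (structm c) 0.

Fact ore_structm_zmod : zmod_morphism ore_structm.
Proof. by move=> c d; rewrite /ore_structm ore_fracN ore_fracD rmorphB. Qed.
Fact ore_structm_monoid : monoid_morphism ore_structm.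
Proof.
by split=> [|c d]; rewrite /ore_structm ?rmorph1 // ore_fracM rmorphM.
Qed.
Fact ore_structm_central c x : ore_structm c * x = x * ore_structm c.
Proof.
elim/ore_frac_ind: x => a k; rewrite !ore_fracM (alg_homC (otau_iter_hom k)).
by rewrite structm_central addn0.
Qed.

HB.instance Definition _ := isPzAlgebra.Build R ore_loc
  ore_structm_zmod ore_structm_monoid ore_structm_central.

Definition ore_inj (a : A) : ore_loc := ore_frac a 0.

(* The following lemmas say that ore_loc is the right Ore localization of A   *)
(* at the powers of f.                                                        *)

Lemma ore_inj_hom : alg_hom ore_inj.
Proof.
split=> // [a b|]; first by rewrite /ore_inj ore_fracN ore_fracD.
by split=> // a b; rewrite /ore_inj ore_fracM.
Qed.

Lemma ore_inj_ker a : ore_inj a = 0 <-> exists k, a * oelt f ^+ k = 0.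
Proof.
split=> [/ore_fracP[k]|[k e]]; first by rewrite mul0r; exists k.
by apply/ore_fracP; exists k; rewrite mul0r.
Qed.

Lemma ore_fracK a k : ore_frac a k * ore_inj (oelt f ^+ k) = ore_inj a.
Proof. by rewrite ore_fracM otau_iterX addn0 (ore_fracXr a 0 k). Qed.

Lemma ore_inj_unit k :
  ore_frac 1 k * ore_inj (oelt f ^+ k) = 1 /\
  ore_inj (oelt f ^+ k) * ore_frac 1 k = 1.
Proof.
split; first exact: ore_fracK.
by rewrite ore_fracM mulr1 -[oelt f ^+ k]mul1r (ore_fracXr 1 0 k).
Qed.

End OreLocalization.

(* ------------------------------------------------------------------------ *)

Section Laurent.
Context (F : fieldType).

(* F[t, 1/t], as the ring of fractions p / t^k inside F(t) *)
Definition laurent_pred : {pred {fraction {poly F}}} := fun u =>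
  `[< exists (p : {poly F}) (k : nat), u = tofrac p / tofrac 'X ^+ k >].

Lemma laurent_predP u :
  reflect (exists (p : {poly F}) (k : nat), u = tofrac p / tofrac 'X ^+ k)
          (u \in laurent_pred).
Proof. exact: asboolP. Qed.

Lemma tofracX_neq0 k : tofrac ('X : {poly F}) ^+ k != 0.
Proof. by rewrite expf_neq0 // tofrac_eq0 polyX_eq0. Qed.

Fact laurent_subring : subring_closed laurent_pred.
Proof.
split=> [|u v|u v].
- by apply/laurent_predP; exists 1, 0%N; rewrite tofrac1 divr1.
- move=> /laurent_predP[p [k ->]] /laurent_predP[r [l ->]].
  apply/laurent_predP; exists (p * 'X^l - r * 'X^k), (k + l)%N.
  rewrite tofracB !tofracM !tofracXn exprD mulrBl !invfM.
  congr (_ - _); first by rewrite mulrACA divff ?mulr1 ?tofracX_neq0.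
  by rewrite [_ ^- k * _]mulrC mulrACA divff ?mulr1 ?tofracX_neq0.
- move=> /laurent_predP[p [k ->]] /laurent_predP[r [l ->]].
  apply/laurent_predP; exists (p * r), (k + l)%N.
  by rewrite tofracM exprD invfM mulrACA.
Qed.

HB.instance Definition _ :=
  GRing.isSubringClosed.Build {fraction {poly F}} laurent_pred laurent_subring.

Record laurent := Laurent { laurent_val :> {fraction {poly F}};
                            _ : laurent_val \in laurent_pred }.

HB.instance Definition _ := [isSub for laurent_val].
HB.instance Definition _ := [Choice of laurent by <:].
HB.instance Definition _ := [SubChoice_isSubComNzRing of laurent by <:].

Fact laurent_t_proof : tofrac 'X \in laurent_pred.
Proof. by apply/laurent_predP; exists 'X, 0%N; rewrite divr1. Qed.
Definition laurent_t : laurent := Laurent laurent_t_proof.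

Fact laurent_tV_proof : (tofrac 'X)^-1 \in laurent_pred.
Proof. by apply/laurent_predP; exists 1, 1%N; rewrite tofrac1 mul1r. Qed.
Definition laurent_tV : laurent := Laurent laurent_tV_proof.

Lemma laurent_tVK : laurent_t * laurent_tV = 1.
Proof. by apply/val_inj; rewrite /= divff // -[tofrac _]expr1 tofracX_neq0. Qed.

Fact laurent_const_proof (c : F) : tofrac c%:P \in laurent_pred.
Proof. by apply/laurent_predP; exists c%:P, 0%N; rewrite divr1. Qed.
Definition laurent_const (c : F) : laurent := Laurent (laurent_const_proof c).

Fact laurent_const_zmod : zmod_morphism laurent_const.
Proof. by move=> c d; apply/val_inj; rewrite /= polyCB tofracB. Qed.
Fact laurent_const_monoid : monoid_morphism laurent_const.
Proof.
split=> [|c d]; apply/val_inj; rewrite /=; first by rewrite tofrac1.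
by rewrite polyCM tofracM.
Qed.

HB.instance Definition _ :=
  GRing.isZmodMorphism.Build F laurent laurent_const laurent_const_zmod.
HB.instance Definition _ :=
  GRing.isMonoidMorphism.Build F laurent laurent_const laurent_const_monoid.

End Laurent.

(* ------------------------------------------------------------------------ *)

Section QuantizedWeyl.
Context (L : comNzRingType) (t : L) (n : nat).

Definition weyl_free := free_alg L ('I_n + 'I_n)%type.

HB.instance Definition _ := PzAlgebra.on weyl_free.

Definition free_x (i : 'I_n) : weyl_free := free_gen L (inl i).
Definition free_d (i : 'I_n) : weyl_free := free_gen L (inr i).

Inductive weyl_rel : weyl_free -> Prop :=
| weyl_rel_dx i j : weyl_rel
    (free_d i * free_x j - structm (t ^+ (i == j)) * free_x j * free_d i
       - (i == j)%:R)
| weyl_rel_xx i j : weyl_rel (free_x i * free_x j - free_x j * free_x i)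
| weyl_rel_dd i j : weyl_rel (free_d i * free_d j - free_d j * free_d i).

(* the quantized Weyl algebra over L with parameter t *)
Definition qweyl : Type := quot_alg weyl_rel.

HB.instance Definition _ := PzAlgebra.on qweyl.

Definition weyl_x (i : 'I_n) : qweyl := quot_pi weyl_rel (free_x i).
Definition weyl_d (i : 'I_n) : qweyl := quot_pi weyl_rel (free_d i).

Definition weyl_fi (i : 'I_n) : qweyl :=
  weyl_d i * weyl_x i - weyl_x i * weyl_d i.
Definition weyl_f : qweyl := \prod_(i < n) weyl_fi i.

Local Notation pi_hom := (quot_pi_hom weyl_rel).

Lemma weyl_dx i j : weyl_d i * weyl_x j =
  structm (t ^+ (i == j)) * weyl_x j * weyl_d i + (i == j)%:R.
Proof.
have := quot_pi_eq0 (weyl_rel_dx i j).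
rewrite !(alg_homB pi_hom) !(alg_homM pi_hom) (alg_homC pi_hom) => e.
apply/eqP; rewrite -subr_eq0 opprD addrA; apply/eqP; rewrite -[RHS]e.
congr (_ - _); case: (i == j); first by rewrite (alg_hom1 pi_hom).
by rewrite (alg_hom0 pi_hom).
Qed.

Lemma weyl_xx i j : weyl_x i * weyl_x j = weyl_x j * weyl_x i.
Proof.
have := quot_pi_eq0 (weyl_rel_xx i j).
by rewrite (alg_homB pi_hom) !(alg_homM pi_hom) => /eqP; rewrite subr_eq0 => /eqP.
Qed.

Lemma weyl_dd i j : weyl_d i * weyl_d j = weyl_d j * weyl_d i.
Proof.
have := quot_pi_eq0 (weyl_rel_dd i j).
by rewrite (alg_homB pi_hom) !(alg_homM pi_hom) => /eqP; rewrite subr_eq0 => /eqP.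
Qed.

Lemma weyl_ind (P : qweyl -> Prop) :
    (forall a b, P a -> P b -> P (a + b)) -> (forall c, P (structm c)) ->
    (forall i a, P a -> P (weyl_x i * a)) ->
    (forall i a, P a -> P (weyl_d i * a)) ->
  forall a, P a.
Proof.
move=> PD PC Px Pd; elim/quot_ind => a.
elim/free_ind: a => [a b|c|[i|i] a].
- by rewrite quot_piD; exact: PD.
- by rewrite (alg_homC pi_hom); exact: PC.
- by rewrite quot_piM; exact: Px.
- by rewrite quot_piM; exact: Pd.
Qed.

Section Lift.
Context (B : pzAlgType L) (x d : 'I_n -> B).
Hypothesis dx : forall i j,
  d i * x j = structm (t ^+ (i == j)) * x j * d i + (i == j)%:R.
Hypothesis xx : forall i j, x i * x j = x j * x i.
Hypothesis dd : forall i j, d i * d j = d j * d i.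

Definition weyl_lift : qweyl -> B :=
  quot_lift (free_lift (fun s => match s with inl i => x i | inr i => d i end)).

Let v s := match s with inl i => x i | inr i => d i end.

Lemma weyl_lift_rel a : weyl_rel a -> free_lift v a = 0.
Proof.
have hv := free_lift_hom v.
have hx i : free_lift v (free_x i) = x i by exact: free_lift_gen.
have hd i : free_lift v (free_d i) = d i by exact: free_lift_gen.
case=> i j; rewrite ?(alg_homB hv) !(alg_homM hv) ?hx ?hd.
- rewrite (alg_homC hv) dx [X in X - _]addrAC subrr add0r.
  case: (i == j); first by rewrite (alg_hom1 hv) subrr.
  by rewrite (alg_hom0 hv) subrr.
- by rewrite xx subrr.
- by rewrite dd subrr.
Qed.

Lemma weyl_lift_hom : alg_hom weyl_lift.
Proof. exact: quot_lift_hom (free_lift_hom v) weyl_lift_rel. Qed.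

Lemma weyl_lift_x i : weyl_lift (weyl_x i) = x i.
Proof.
by rewrite /weyl_lift (quot_liftE (free_lift_hom v) weyl_lift_rel) free_lift_gen.
Qed.

Lemma weyl_lift_d i : weyl_lift (weyl_d i) = d i.
Proof.
by rewrite /weyl_lift (quot_liftE (free_lift_hom v) weyl_lift_rel) free_lift_gen.
Qed.

End Lift.

Context (tV : L) (tVK : t * tV = 1).

(* The automorphism x_i |-> x_i / t, d_i |-> t d_i satisfies a f = f tau(a).  *)
(* As it is bijective, the left and right Ore localizations at the powers of  *)
(* f coincide.                                                                *)
Definition weyl_tau : qweyl -> qweyl :=
  weyl_lift (fun i => structm tV * weyl_x i)
            (fun i => structm t * weyl_d i).

Lemma structm_mul (c d : L) (a b : qweyl) :
  structm c * a * (structm d * b) = structm (c * d) * (a * b).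
Proof.
by rewrite rmorphM -!mulrA; congr (_ * _); rewrite !mulrA structm_central.
Qed.

Let tau_dx i j : structm t * weyl_d i * (structm tV * weyl_x j) =
  structm (t ^+ (i == j)) * (structm tV * weyl_x j) *
    (structm t * weyl_d i) + (i == j)%:R.
Proof.
rewrite -[structm _ * (structm _ * _) * _]mulrA !structm_mul tVK.
by rewrite [_ * t]mulrC tVK rmorph1 !mul1r weyl_dx mulrA.
Qed.

Let tau_xx i j :
  structm tV * weyl_x i * (structm tV * weyl_x j) =
  structm tV * weyl_x j * (structm tV * weyl_x i).
Proof. by rewrite !structm_mul weyl_xx. Qed.

Let tau_dd i j : structm t * weyl_d i * (structm t * weyl_d j) =
  structm t * weyl_d j * (structm t * weyl_d i).
Proof. by rewrite !structm_mul weyl_dd. Qed.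

Lemma weyl_tau_hom : alg_hom weyl_tau.
Proof. exact: weyl_lift_hom tau_dx tau_xx tau_dd. Qed.

Lemma weyl_tau_x i : weyl_tau (weyl_x i) = structm tV * weyl_x i.
Proof. exact: weyl_lift_x tau_dx tau_xx tau_dd i. Qed.

Lemma weyl_tau_d i : weyl_tau (weyl_d i) = structm t * weyl_d i.
Proof. exact: weyl_lift_d tau_dx tau_xx tau_dd i. Qed.

Lemma weyl_tau_fi i : weyl_tau (weyl_fi i) = weyl_fi i.
Proof.
rewrite (alg_homB weyl_tau_hom) !(alg_homM weyl_tau_hom) weyl_tau_x weyl_tau_d.
by rewrite !structm_mul [tV * _]mulrC tVK rmorph1 !mul1r.
Qed.

Lemma weyl_tau_f : weyl_tau weyl_f = weyl_f.
Proof.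
rewrite (alg_hom_prod weyl_tau_hom); apply: eq_bigr => i _.
exact: weyl_tau_fi.
Qed.

Let dxii i : weyl_d i * weyl_x i = structm t * weyl_x i * weyl_d i + 1.
Proof. by rewrite weyl_dx eqxx expr1. Qed.

Let dxij i j : i != j -> weyl_d i * weyl_x j = weyl_x j * weyl_d i.
Proof. by move/negPf=> ij; rewrite weyl_dx ij expr0 rmorph1 mul1r addr0. Qed.

Lemma weyl_fi_x i j : weyl_fi i * weyl_x j =
  structm (t ^+ (i == j)) * (weyl_x j * weyl_fi i).
Proof.
case: eqVneq => [<-|ij]; last first.
  rewrite expr0 rmorph1 mul1r /weyl_fi mulrBl mulrBr -!mulrA.
  by rewrite (dxij ij) weyl_xx !mulrA (dxij ij) [weyl_x i * _]weyl_xx.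
rewrite expr1 /weyl_fi mulrBl !mulrBr; set x := weyl_x i; set d := weyl_d i.
have E : structm t * (x * (x * d)) = x * d * x - x.
  by rewrite -mulrA dxii mulrDr mulr1 addrK !mulrA structm_central.
have E' : d * x * x = structm t * (x * (d * x)) + x.
  by rewrite [X in X * x]dxii mulrDl mul1r !mulrA.
by rewrite E E' opprB addrA.
Qed.

Lemma weyl_fi_d i j : weyl_d j * weyl_fi i =
  structm (t ^+ (i == j)) * (weyl_fi i * weyl_d j).
Proof.
case: eqVneq => [<-|ij]; last first.
  rewrite eq_sym in ij.
  rewrite expr0 rmorph1 mul1r /weyl_fi mulrBl mulrBr !mulrA.
  by rewrite weyl_dd (dxij ij) -!mulrA (dxij ij) [weyl_d j * _]weyl_dd.
rewrite expr1 /weyl_fi mulrBl !mulrBr; set x := weyl_x i; set d := weyl_d i.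
have E : structm t * (x * d * d) = d * x * d - d.
  by rewrite dxii mulrDl mul1r addrK !mulrA.
have E' : d * (d * x) = structm t * (d * x * d) + d.
  by rewrite [X in d * X = _]dxii mulrDr mulr1 !mulrA structm_central.
by rewrite E E' opprB !mulrA addrA.
Qed.

Lemma weyl_prod_comm (c : 'I_n -> L) a (r : seq 'I_n) :
    (forall i, a * weyl_fi i = weyl_fi i * (structm (c i) * a)) ->
  a * \prod_(i <- r) weyl_fi i =
  \prod_(i <- r) weyl_fi i * (structm (\prod_(i <- r) c i) * a).
Proof.
move=> ac; elim: r => [|i r IHr]; first by rewrite !big_nil rmorph1 !mul1r mulr1.
rewrite !big_cons mulrA ac -!mulrA IHr rmorphM !mulrA.
by rewrite -[_ * structm (c i) * _]mulrA structm_central !mulrA.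
Qed.

Lemma weyl_fE a : a * weyl_f = weyl_f * weyl_tau a.
Proof.
have prodc (s : L) (j : 'I_n) : \prod_(i < n) s ^+ (i == j) = s.
  rewrite (bigD1 j) //= eqxx big1 ?mulr1 // => i /negPf ->.
  by rewrite expr0.
have tVt k : structm (tV ^+ k) * structm (t ^+ k) = 1 :> qweyl.
  by rewrite -rmorphM -exprMn mulrC tVK expr1n rmorph1.
have h := weyl_tau_hom.
elim/weyl_ind: a => [a b ha hb|c|j a ha|j a ha].
- by rewrite mulrDl ha hb (alg_homD h) mulrDr.
- by rewrite (alg_homC h) structm_central.
- rewrite -mulrA ha (alg_homM h) weyl_tau_x !mulrA; congr (_ * _).
  rewrite (@weyl_prod_comm (fun i => tV ^+ (i == j))) ?prodc ?mulrA // => i.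
  rewrite mulrA -structm_central -mulrA weyl_fi_x mulrA tVt mul1r //.
- rewrite -mulrA ha (alg_homM h) weyl_tau_d !mulrA; congr (_ * _).
  rewrite (@weyl_prod_comm (fun i => t ^+ (i == j))) ?prodc ?mulrA // => i.
  by rewrite weyl_fi_d !mulrA structm_central.
Qed.

Definition weyl_ore : ore_elt qweyl :=
  OreElt weyl_tau_hom weyl_tau_f weyl_fE.

End QuantizedWeyl.

Section WeylAlgebras.
Context (F : fieldType) (n : nat).

(* A_n^(t), an algebra over F[t, 1/t] *)
Definition weyl_t : Type := qweyl (laurent_t F) n.

HB.instance Definition _ := PzAlgebra.on weyl_t.

(* A_{n,f}^(t), the Ore localization of A_n^(t) at the powers of f *)
Definition weyl_tf : Type := ore_loc (weyl_ore n (laurent_tVK F)).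

HB.instance Definition _ := PzAlgebra.on weyl_tf.

Variant weyl_q_rel (q : F) : weyl_t -> Prop :=
  WeylQRel : weyl_q_rel q (structm (laurent_t F - laurent_const q)).

(* A_n^q = A_n^(t) / (t - q), an algebra over F *)
Definition weyl_q (q : F) : Type :=
  restrict_scalars (@laurent_const F) (quot_alg (weyl_q_rel q)).

HB.instance Definition _ q := PzAlgebra.on (weyl_q q).

Definition weyl_q_pi (q : F) (a : weyl_t) : weyl_q q :=
  quot_pi (weyl_q_rel q) a.

Lemma weyl_q_structm q c :
  structm c = weyl_q_pi q (structm (laurent_const c)).
Proof. by []. Qed.

Lemma weyl_q_t q : weyl_q_pi q (structm (laurent_t F)) = structm q.
Proof.
have H := quot_pi_hom (weyl_q_rel q).
apply/eqP; rewrite -subr_eq0; apply/eqP.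
by rewrite -[RHS](quot_pi_eq0 (WeylQRel q)) rmorphB (alg_homB H).
Qed.

End WeylAlgebras.

Arguments weyl_q : clear implicits.

(* Main.v *)
(* The left regular representation, in the normal ordering "x to the left of
   d", is realized on formal power series in 2n variables; the image of 1 (the
   symbol) determines an element of the algebra, for an arbitrary parameter t in
   an arbitrary commutative ring (PBW theorem).

   (i) The endomorphism "twist" fixes the generators except for
   d_1 |-> d_1 + f_1 = 1 + g d_1, where g = 1 - (1 - t) x_1.  As g is
   invertible on power series, d_1 |-> g^-1 (d_1 - 1) defines a representation
   whose composite with twist is the faithful regular one, so twist is injective.
   In a two-dimensional representation, d_1 is not diagonal while x_1 and
   d_1 + f_1 are, so twist is not surjective.

   (ii) For q <> 1, x_i |-> 1, d_i |-> 1 / (1 - q) is a character, whose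
   image consists of scalars, and x_1 is not a scalar.

   (iii) At t = 1 the algebra becomes the Weyl algebra over a field of
   characteristic 0, which is simple: the commutators with the generators
   differentiate the symbol.  If h kills a <> 0, write a = (t - 1)^k b with b
   nonzero at t = 1.  The target has no (t - 1)-torsion, so h kills b; but then
   h induces at t = 1 a unital homomorphism from the Weyl algebra with nonzero
   kernel.  Since f = 1 at t = 1, this applies to the localization as well. *)

Require Import Defs.
From HB Require Import structures.
From mathcomp Require Import all_boot all_algebra reals zify.
From mathcomp Require Import boolp functions.
From mathcomp.real_closed Require Import complex.

Set Implicit Arguments.
Unset Strict Implicit.
Unset Printing Implicit Defensive.

Import GRing.Theory.
Local Open Scope ring_scope.

(** * Endomorphism algebras *)

Section Endomorphisms.
Context (L : comNzRingType) (V : lmodType L).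

Definition endo_pred : {pred V -> V} := fun f => `[< linear f >].

Lemma endo_zmod_closed : zmod_closed endo_pred.
Proof.
split=> [|f g /asboolP lf /asboolP lg]; apply/asboolP => c u v /=.
  by rewrite scaler0 addr0.
by rewrite !fctE /= lf lg scalerBr opprD addrACA.
Qed.

HB.instance Definition _ :=
  GRing.isZmodClosed.Build (V -> V) endo_pred endo_zmod_closed.

Record endo := Endo { endo_val :> V -> V; _ : endo_val \in endo_pred }.

HB.instance Definition _ := [isSub for endo_val].
HB.instance Definition _ := [Choice of endo by <:].
HB.instance Definition _ := [SubChoice_isSubZmodule of endo by <:].

Lemma endoP (f g : endo) : f =1 g -> f = g.
Proof. by move=> fg; apply/val_inj/funext. Qed.

Lemma endo_linear (f : endo) : linear f.
Proof. by apply/asboolP; case: f. Qed.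

Lemma endo_raddf (f : endo) u v : f (u + v) = f u + f v.
Proof. by have := endo_linear f 1 u v; rewrite !scale1r. Qed.

Lemma endo_v0 (f : endo) : f 0 = 0.
Proof. by apply: (addrI (f 0)); rewrite -endo_raddf !addr0. Qed.

Lemma endo_rscale (f : endo) c v : f (c *: v) = c *: f v.
Proof. by rewrite -[c *: v]addr0 endo_linear endo_v0 addr0. Qed.

Lemma endoD (f g : endo) v : (f + g) v = f v + g v. Proof. by []. Qed.
Lemma endoB (f g : endo) v : (f - g) v = f v - g v. Proof. by []. Qed.

Fact endo_one_proof : (@id V) \in endo_pred.
Proof. by apply/asboolP. Qed.
Definition endo_one : endo := Endo endo_one_proof.

Fact endo_mul_proof (f g : endo) : (f \o g) \in endo_pred.
Proof. by apply/asboolP => c u v /=; rewrite !endo_linear. Qed.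
Definition endo_mul (f g : endo) : endo := Endo (endo_mul_proof f g).

Fact endo_mulA : associative endo_mul. Proof. by move=> f g h; apply: endoP. Qed.
Fact endo_mul1 : left_id endo_one endo_mul. Proof. by move=> f; apply: endoP. Qed.
Fact endo_mulr1 : right_id endo_one endo_mul. Proof. by move=> f; apply: endoP. Qed.
Fact endo_mulDl : left_distributive endo_mul +%R.
Proof. by move=> f g h; apply: endoP. Qed.
Fact endo_mulDr : right_distributive endo_mul +%R.
Proof.
by move=> f g h; apply: endoP => v; exact: endo_raddf.
Qed.

HB.instance Definition _ := GRing.Zmodule_isPzRing.Build endo
  endo_mulA endo_mul1 endo_mulr1 endo_mulDl endo_mulDr.

Lemma endoM (f g : endo) v : (f * g) v = f (g v). Proof. by []. Qed.
Lemma endo1 v : (1 : endo) v = v. Proof. by []. Qed.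

Fact endo_scalar_proof (c : L) : (fun v : V => c *: v) \in endo_pred.
Proof.
by apply/asboolP => a u v; rewrite scalerDr !scalerA mulrC.
Qed.
Definition endo_scalar (c : L) : endo := Endo (endo_scalar_proof c).

Fact endo_scalar_zmod : zmod_morphism endo_scalar.
Proof. by move=> c d; apply: endoP => v; rewrite endoB /= scalerBl. Qed.
Fact endo_scalar_monoid : monoid_morphism endo_scalar.
Proof.
split=> [|c d]; apply: endoP => v; first by rewrite /= scale1r.
by rewrite endoM /= scalerA.
Qed.
Fact endo_scalar_central c f : endo_scalar c * f = f * endo_scalar c.
Proof.
by apply: endoP => v; rewrite !endoM /= endo_rscale.
Qed.

HB.instance Definition _ := isPzAlgebra.Build L endo
  endo_scalar_zmod endo_scalar_monoid endo_scalar_central.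

Lemma endoC (c : L) v : (structm c : endo) v = c *: v. Proof. by []. Qed.

End Endomorphisms.

(** * Operators on power series *)

Section Multiindices.
Context (I : finType).
Implicit Types (s r : I) (e : {ffun I -> nat}) (k : nat).

Definition upd s k e : {ffun I -> nat} := [ffun j => if j == s then k else e j].

Lemma upd_eq s k e : upd s k e s = k. Proof. by rewrite ffunE eqxx. Qed.
Lemma upd_neq s r k e : r != s -> upd s k e r = e r.
Proof. by rewrite ffunE => /negPf ->. Qed.
Lemma upd_id s e : upd s (e s) e = e.
Proof. by apply/ffunP => j; rewrite ffunE; case: eqP => // ->. Qed.
Lemma upd_upd s k l e : upd s k (upd s l e) = upd s k e.
Proof. by apply/ffunP => j; rewrite !ffunE; case: eqP. Qed.
Lemma upd_comm s r k l e : s != r -> upd s k (upd r l e) = upd r l (upd s k e).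
Proof.
by move=> sr; apply/ffunP => j; rewrite !ffunE; case: eqVneq => // ->; rewrite (negPf sr).
Qed.

Definition incr s e := upd s (e s).+1 e.

Lemma incr_eq s e : incr s e s = (e s).+1. Proof. exact: upd_eq. Qed.
Lemma incr_neq s r e : r != s -> incr s e r = e r. Proof. exact: upd_neq. Qed.
Lemma incr_upd s e : (0 < e s)%N -> incr s (upd s (e s).-1 e) = e.
Proof. by move=> e0; rewrite /incr upd_eq upd_upd prednK // upd_id. Qed.

Definition mdeg e := (\sum_s e s)%N.

Lemma mdeg_upd s k e : (mdeg (upd s k e) + e s = mdeg e + k)%N.
Proof.
rewrite /mdeg (bigD1 s) //= [in RHS](bigD1 s) //= upd_eq.
rewrite (eq_bigr e) => [|r rs]; last exact: upd_neq.
by rewrite addnC addnA [RHS]addnAC.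
Qed.

Lemma mdeg_incr s e : mdeg (incr s e) = (mdeg e).+1.
Proof. have := mdeg_upd s (e s).+1 e; rewrite -/(incr s e); lia. Qed.

Lemma mdeg_eq0 e : mdeg e = 0%N -> e = [ffun => 0%N].
Proof.
by move=> /eqP; rewrite sum_nat_eq0 => /forallP h; apply/ffunP => s;
  rewrite ffunE; apply/eqP; exact: h.
Qed.

Lemma mdeg_gt0 e : mdeg e != 0%N -> exists s, (0 < e s)%N.
Proof.
rewrite sum_nat_eq0 negb_forall => /existsP[s].
by rewrite -lt0n => ?; exists s.
Qed.

Context (L : comNzRingType).
Local Notation V := ({ffun I -> nat} -> L^o).

Lemma vscaleE (c : L) (u : V) e : (c *: u) e = c * u e. Proof. by []. Qed.
Lemma vaddE (u v : V) e : (u + v) e = u e + v e. Proof. by []. Qed.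

(* A function u : V stands for the power series with coefficients u e; the *)
(* operator below acts on the s-th variable only.                           *)
Fact coord_op_proof s (w : nat -> L) (g : nat -> nat) :
  (fun (u : V) e => w (e s) * u (upd s (g (e s)) e)) \in @endo_pred L V.
Proof.
apply/asboolP => c u v; apply/funext => e.
by rewrite !fctE /= mulrDr /GRing.scale /= mulrCA.
Qed.
Definition coord_op s (w : nat -> L) (g : nat -> nat) : endo V := Endo (coord_op_proof s w g).

Lemma coord_opE s w g (u : V) e : coord_op s w g u e = w (e s) * u (upd s (g (e s)) e).
Proof. by []. Qed.

Lemma coord_op_comm s r w g w' g' : s != r -> coord_op s w g * coord_op r w' g' = coord_op r w' g' * coord_op s w g.
Proof.
move=> sr; apply: endoP => u; apply/funext => e.
rewrite !endoM !coord_opE upd_neq 1?eq_sym // upd_neq // upd_comm 1?eq_sym //.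
by rewrite mulrCA.
Qed.

(** The monomial with exponent [e]; [vdelta L [ffun => 0%N]] is the power series 1. *)
Definition vdelta e : V := fun e' => (e' == e)%:R.

(** Multiplication by the [s]-th variable. As [predn 0] is 0, the weight has to kill the value at
    exponent 0. *)
Definition shift s := coord_op s (fun k => (0 < k)%:R) predn.

Lemma shiftE s (u : V) e :
  shift s u e = if (0 < e s)%N then u (upd s (e s).-1 e) else 0.
Proof. by rewrite coord_opE; case: ltnP; rewrite ?mul1r ?mul0r. Qed.

Lemma shift_comm s r : shift s * shift r = shift r * shift s.
Proof. by have [->|] := eqVneq s r; [|exact: coord_op_comm]. Qed.

Lemma shift_vdelta s e : shift s (vdelta e) = vdelta (incr s e).
Proof.
apply/funext => e'; rewrite shiftE /vdelta; case: ltnP => [e's|].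
  congr (_%:R); congr nat_of_bool; apply/eqP/eqP => [<-|->]; first by rewrite incr_upd.
  by rewrite incr_eq /incr upd_upd upd_id.
by case: eqP => [->|//]; rewrite incr_eq.
Qed.

Context (t : L).

(* qnum k = 1 + t + ... + t^(k-1), so that qder is the t-derivative. *)
Fixpoint qnum k := if k is k'.+1 then 1 + t * qnum k' else 0.

Definition qder s := coord_op s (fun k => qnum k.+1) succn.
(** The substitution of t X_s for X_s. *)
Definition qscale s := coord_op s (fun k => t ^+ k) id.

Lemma qderE s (u : V) e : qder s u e = qnum (e s).+1 * u (incr s e).
Proof. by []. Qed.
Lemma qscaleE s (u : V) e : qscale s u e = t ^+ e s * u e.
Proof. by rewrite coord_opE upd_id. Qed.

Lemma qder_shift s : qder s * shift s = structm t * shift s * qder s + 1.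
Proof.
apply: endoP => u; apply/funext => e.
rewrite endoD !endoM endoC endo1 vaddE vscaleE qderE !shiftE incr_eq ltn0Sn [qnum _]/=.
rewrite /incr upd_upd upd_id mulrDl mul1r addrC; congr (_ + _).
case: ltnP => [e0|]; last by rewrite leqn0 => /eqP ->; rewrite /= !mulr0 mul0r.
by rewrite qderE incr_upd // upd_eq prednK // mulrA.
Qed.

Lemma qscale_shift s : qscale s * shift s = structm t * shift s * qscale s.
Proof.
apply: endoP => u; apply/funext => e.
rewrite !endoM endoC vscaleE qscaleE !shiftE.
case: ltnP => [e0|]; last by rewrite !mulr0.
by rewrite qscaleE upd_eq -[in LHS](prednK e0) exprS mulrA.
Qed.

Lemma qder_vdelta s e : e s = 0%N -> qder s (vdelta e) = 0.
Proof.
move=> e0; apply/funext => e'; rewrite qderE /vdelta; case: eqP => [ee|]; last by rewrite mulr0.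
by move: e0; rewrite -ee incr_eq.
Qed.

Lemma qscale_vdelta s e : qscale s (vdelta e) = t ^+ e s *: vdelta e.
Proof.
apply/funext => e'; rewrite qscaleE vscaleE /vdelta.
by case: eqP => [-> //|]; rewrite !mulr0.
Qed.

End Multiindices.

(** * The regular representation and the PBW theorem *)

Section TwistedLeibniz.
Context (R : pzRingType).
Implicit Types a b c d s : R.

(** Made for [rep_d]: [a] rescales a variable, [b] multiplies by another one, [d] is the
    t-derivative. *)
Lemma twisted_leibniz a b c d s : b * s = s * b -> a * s = c * s * a ->
  d * s = c * s * d + 1 -> (a * b + d) * s = c * s * (a * b + d) + 1.
Proof.
move=> bs as_ ds; rewrite mulrDl ds mulrDr addrA; congr (_ + _ + _).
by rewrite -mulrA bs mulrA as_ mulrA.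
Qed.

Lemma commrD_mul a b d s : GRing.comm a s -> GRing.comm b s -> GRing.comm d s ->
  GRing.comm (a * b + d) s.
Proof.
by move=> as_ bs ds; apply/commr_sym/commrD; first apply: commrM; apply: commr_sym.
Qed.

End TwistedLeibniz.

Section CommutingProducts.
Context (R : pzRingType) (I : finType) (y : I -> R).
Hypothesis yy : forall i j, y i * y j = y j * y i.

(** Exponents are plain functions, so that either half of a multi-index on ['I_n + 'I_n] can be
    plugged in. *)
Lemma prod_commute_incr i (e e' : I -> nat) :
    e' i = (e i).+1 -> (forall j, j != i -> e' j = e j) ->
  y i * \prod_j y j ^+ e j = \prod_j y j ^+ e' j.
Proof.
move=> e'i e'j; have : i \in index_enum I by rewrite mem_index_enum.
elim: (index_enum I) (index_enum_uniq I) => // j r IHr /= /andP[jr ur].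
rewrite !big_cons inE; case: eqVneq => [ij _|ij /= ir].
  subst j; rewrite mulrA -exprS e'i; congr (_ * _); apply: eq_big_seq => j jr'.
  by rewrite e'j //; apply: contraNneq jr => <-.
rewrite mulrA (commrX _ (yy i j)) -mulrA IHr // e'j //; by rewrite eq_sym.
Qed.

End CommutingProducts.

Section Symbol.
Context (L : comNzRingType) (t : L) (n : nat).
Local Notation I := ('I_n + 'I_n)%type.
Local Notation A := (qweyl t n).
Local Notation V := ({ffun I -> nat} -> L^o).
Local Notation sh := (@shift _ L).

(* The inl variables are the symbols of the x_i, the inr ones of the d_i. *)
Definition rep_x (i : 'I_n) : endo V := sh (inl i).
(** Left multiplication by d_i on normally ordered series: d_i x_i^k = t^k x_i^k d_i + [qnum k]
    x_i^(k-1). *)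
Definition rep_d (i : 'I_n) : endo V :=
  qscale t (inl i) * sh (inr i) + qder t (inl i).

Lemma rep_dx i j : rep_d i * rep_x j =
  structm (t ^+ (i == j)) * rep_x j * rep_d i + (i == j)%:R.
Proof.
have rl k l : sh (inr k) * sh (inl l) = sh (inl l) * sh (inr k) by exact: coord_op_comm.
case: eqVneq => [<-|ij].
  rewrite expr1; apply: twisted_leibniz; [exact: rl|exact: qscale_shift|exact: qder_shift].
have ll : inl i != inl j :> I by apply: contra ij => /eqP[->].
rewrite expr0 rmorph1 mul1r addr0.
by apply: commrD_mul; [exact: coord_op_comm | exact: rl | exact: coord_op_comm].
Qed.

Lemma rep_xx i j : rep_x i * rep_x j = rep_x j * rep_x i.
Proof. exact: shift_comm. Qed.

Lemma rep_d_shift i l : GRing.comm (rep_d i) (sh (inr l)).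
Proof.
by apply: commrD_mul; [exact: coord_op_comm|exact: shift_comm|exact: coord_op_comm].
Qed.

Lemma rep_dd i j : rep_d i * rep_d j = rep_d j * rep_d i.
Proof.
have [->//|ij] := eqVneq i j.
have ll : inl i != inl j :> I by apply: contra ij => /eqP[->].
have ll' : inl j != inl i :> I by rewrite eq_sym.
have D k l : inl k != inl l :> I -> GRing.comm (rep_d k) (qder t (inl l)).
  move=> kl; apply: commrD_mul; exact: coord_op_comm.
have Q k l : inl k != inl l :> I -> GRing.comm (rep_d k) (qscale t (inl l)).
  move=> kl; apply: commrD_mul; exact: coord_op_comm.
by apply: commrD; [apply: commrM; [exact: Q|exact: rep_d_shift]|exact: D].
Qed.

Definition rep : A -> endo V := weyl_lift rep_x rep_d.

Lemma rep_hom : alg_hom rep.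
Proof. exact: weyl_lift_hom rep_dx rep_xx rep_dd. Qed.
Lemma rep_weyl_x i : rep (weyl_x t i) = rep_x i.
Proof. exact: weyl_lift_x rep_dx rep_xx rep_dd i. Qed.
Lemma rep_weyl_d i : rep (weyl_d t i) = rep_d i.
Proof. exact: weyl_lift_d rep_dx rep_xx rep_dd i. Qed.

Definition symbol (a : A) : V := rep a (vdelta L [ffun => 0%N]).

Lemma symbolD a b : symbol (a + b) = symbol a + symbol b.
Proof. by rewrite /symbol (alg_homD rep_hom). Qed.
Lemma symbolB a b : symbol (a - b) = symbol a - symbol b.
Proof. by rewrite /symbol (alg_homB rep_hom). Qed.
Lemma symbol0 : symbol 0 = 0.
Proof. by rewrite /symbol (alg_hom0 rep_hom). Qed.
Lemma symbolM a b : symbol (a * b) = rep a (symbol b).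
Proof. by rewrite /symbol (alg_homM rep_hom). Qed.
Lemma symbolC c : symbol (structm c) = c *: vdelta L [ffun => 0%N].
Proof. by rewrite /symbol (alg_homC rep_hom). Qed.
Lemma symbolZ c a : symbol (structm c * a) = c *: symbol a.
Proof. by rewrite symbolM (alg_homC rep_hom). Qed.
Lemma symbol_sum (T : Type) (r : seq T) (F : T -> A) :
  symbol (\sum_(j <- r) F j) = \sum_(j <- r) symbol (F j).
Proof. exact: (big_morph _ symbolD symbol0). Qed.

Definition wmon (e : {ffun I -> nat}) : A :=
  (\prod_i weyl_x t i ^+ e (inl i)) * (\prod_i weyl_d t i ^+ e (inr i)).

Lemma wmon0 : wmon [ffun => 0%N] = 1.
Proof. by rewrite /wmon !big1 ?mulr1 // => i _; rewrite ffunE. Qed.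

Lemma wmon_x i (e : {ffun I -> nat}) : weyl_x t i * wmon e = wmon (incr (inl i) e).
Proof.
rewrite /wmon.
have <- : weyl_x t i * \prod_j weyl_x t j ^+ e (inl j) =
    \prod_j weyl_x t j ^+ incr (inl i) e (inl j).
  apply: (prod_commute_incr (@weyl_xx _ t n)); first by rewrite incr_eq.
  by move=> j ji; rewrite incr_neq //; apply: contra ji => /eqP[->].
by rewrite mulrA; congr (_ * _); apply: eq_bigr => j _; rewrite incr_neq.
Qed.

Lemma wmon_d i (e : {ffun I -> nat}) : (forall j, e (inl j) = 0%N) ->
  weyl_d t i * wmon e = wmon (incr (inr i) e).
Proof.
move=> e0; have x1 (e' : {ffun I -> nat}) : (forall j, e' (inl j) = 0%N) ->
    \prod_j weyl_x t j ^+ e' (inl j) = 1.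
  by move=> e'0; rewrite big1 // => j _; rewrite e'0.
rewrite /wmon !x1 ?mul1r // => [|j]; last by rewrite incr_neq.
apply: (prod_commute_incr (@weyl_dd _ t n)); first by rewrite incr_eq.
by move=> j ji; rewrite incr_neq //; apply: contra ji => /eqP[->].
Qed.

(** Monomials are built by multiplication on the left, first by the d_i and then by the x_i, since
    [wmon_d] prepends d_i only when no x_j is present. *)
Lemma multi_ind (P : {ffun I -> nat} -> Prop) :
    P [ffun => 0%N] ->
    (forall i (e : {ffun I -> nat}), (forall j, e (inl j) = 0%N) -> P e -> P (incr (inr i) e)) ->
    (forall i (e : {ffun I -> nat}), P e -> P (incr (inl i) e)) ->
  forall e, P e.
Proof.
move=> P0 Pr Pl e; have [k] := ubnP (mdeg e); elim: k e => // k IHk e ek.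
have step s : (0 < e s)%N -> P (upd s (e s).-1 e).
  move=> es; apply: IHk; have := mdeg_incr s (upd s (e s).-1 e).
  by rewrite incr_upd // => E; rewrite E in ek.
case: (boolP [exists j, 0 < e (inl j)])%N => [/existsP[j ej]|].
  by rewrite -(incr_upd ej); apply: Pl; exact: step.
rewrite negb_exists => /forallP e0.
have {}e0 j : e (inl j) = 0%N by apply/eqP; rewrite -leqn0 leqNgt.
have [/mdeg_eq0 -> //|/mdeg_gt0[[j|j] ej]] := eqVneq (mdeg e) 0%N.
  by rewrite e0 in ej.
rewrite -(incr_upd ej); apply: Pr; last exact: step.
by move=> i; rewrite upd_neq.
Qed.

(** On a monomial without x the t-derivative vanishes and the rescaling is trivial, so [rep_d]
    merely raises an exponent. This is the linear independence in the PBW theorem. *)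
Lemma symbol_wmon e : symbol (wmon e) = vdelta L e.
Proof.
elim/multi_ind: e => [|i e e0 IH|i e IH].
- by rewrite wmon0 -(rmorph1 (@structm L A)) symbolC scale1r.
- rewrite -wmon_d // symbolM IH rep_weyl_d /rep_d endoD endoM qder_vdelta //.
  by rewrite addr0 shift_vdelta qscale_vdelta incr_neq // e0 expr0 scale1r.
- by rewrite -wmon_x symbolM IH rep_weyl_x /rep_x shift_vdelta.
Qed.

Definition wcomb (l : seq (L * {ffun I -> nat})) : A :=
  \sum_(p <- l) structm p.1 * wmon p.2.

Lemma wcomb_scale c l : exists l', structm c * wcomb l = wcomb l'.
Proof.
exists [seq (c * p.1, p.2) | p <- l].
rewrite /wcomb big_map mulr_sumr; apply: eq_bigr => p _ /=.
by rewrite rmorphM mulrA.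
Qed.

Lemma wcomb_add l l' : wcomb l + wcomb l' = wcomb (l ++ l').
Proof. by rewrite /wcomb big_cat. Qed.

Lemma wcomb_x i l : exists l', weyl_x t i * wcomb l = wcomb l'.
Proof.
exists [seq (p.1, incr (inl i) p.2) | p <- l].
rewrite /wcomb big_map mulr_sumr; apply: eq_bigr => p _ /=.
by rewrite -wmon_x !mulrA structm_central.
Qed.

Lemma wmon_comb e : wmon e = wcomb [:: (1, e)].
Proof. by rewrite /wcomb big_seq1 rmorph1 mul1r. Qed.

(** The part of the spanning property that uses the relation: d_i moves past the leading x_j to a
    monomial already treated, and for i = j that monomial itself is left over. *)
Lemma wcomb_d i l : exists l', weyl_d t i * wcomb l = wcomb l'.
Proof.
have dmon e : exists l', weyl_d t i * wmon e = wcomb l'.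
  elim/multi_ind: e => [|j e e0 _|j e [l' IH]].
  - by exists [:: (1, incr (inr i) [ffun => 0%N])];
      rewrite wmon_d -?wmon_comb // => j; rewrite ffunE.
  - exists [:: (1, incr (inr i) (incr (inr j) e))].
    by rewrite wmon_d -?wmon_comb // => k; rewrite incr_neq.
  - rewrite -wmon_x mulrA weyl_dx mulrDl -!mulrA IH.
    have [l1 ->] := wcomb_x j l'; have [l2 ->] := wcomb_scale (t ^+ (i == j)) l1.
    case: (i == j); last by exists l2; rewrite mul0r addr0.
    by exists (l2 ++ [:: (1, e)]); rewrite -wcomb_add mul1r -wmon_comb.
elim: l => [|p l [l1 IHl]]; first by exists [::]; rewrite /wcomb !big_nil mulr0.
have [l2 Hl] := dmon p.2; have [l3 Hl3] := wcomb_scale p.1 l2.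
exists (l3 ++ l1); rewrite -wcomb_add -IHl -Hl3 -Hl /wcomb big_cons mulrDr.
by rewrite !mulrA structm_central.
Qed.

Lemma wcomb_span a : exists l, a = wcomb l.
Proof.
elim/weyl_ind: a => [a b [l1 ->] [l2 ->]|c|i a [l ->]|i a [l ->]].
- by exists (l1 ++ l2); rewrite wcomb_add.
- exists [:: (c, [ffun => 0%N])].
  by rewrite /wcomb big_seq1 wmon0 mulr1.
- exact: wcomb_x.
- exact: wcomb_d.
Qed.

Lemma symbol_comb l e : symbol (wcomb l) e = \sum_(p <- l) p.1 * (e == p.2)%:R.
Proof.
rewrite /wcomb symbol_sum fct_sumE; apply: eq_bigr => p _.
by rewrite symbolZ symbol_wmon.
Qed.

Lemma symbol_expansion a : exists r : seq {ffun I -> nat},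
  (forall e, symbol a e != 0 -> e \in r) /\
  a = \sum_(e <- r) structm (symbol a e) * wmon e.
Proof.
have [l ->] := wcomb_span a.
(* [l] may repeat a multi-index: [undup] keeps each monomial once, and exchanging the two sums
   collects its coefficients. *)
pose r := undup [seq p.2 | p <- l]; exists r; split=> [e|].
  apply: contraR; rewrite mem_undup symbol_comb => er; apply/eqP.
  rewrite big_seq big1 // => p pl; case: eqP => [ep|]; last by rewrite mulr0.
  by rewrite ep map_f in er.
under eq_bigr => e _ do rewrite symbol_comb raddf_sum mulr_suml.
rewrite exchange_big /= /wcomb; apply: eq_big_seq => p pl.
rewrite (bigD1_seq p.2) ?undup_uniq ?mem_undup ?map_f //= eqxx mulr1.
rewrite big1 ?addr0 // => e /negPf ->.
by rewrite mulr0 rmorph0 mul0r.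
Qed.

Lemma symbol_inj0 a : symbol a = 0 -> a = 0.
Proof.
move=> s0; have [r [_ ->]] := symbol_expansion a.
by rewrite big1 // => e _; rewrite s0 rmorph0 mul0r.
Qed.

Lemma symbol_bounded a : exists k, forall e, (k < mdeg e)%N -> symbol a e = 0.
Proof.
(* The sum of all degrees in [r] is a crude bound for each of them. *)
have [r [rP _]] := symbol_expansion a; exists (\sum_(e <- r) mdeg e)%N => e.
move=> re; apply/eqP; apply: contraTT re => /rP er.
by rewrite -leqNgt (big_rem e) //= leq_addr.
Qed.

Lemma weyl_oner_neq0 : 1 != 0 :> A.
Proof.
apply/eqP => /(congr1 symbol)/(congr1 (fun u => u [ffun => 0%N])).
rewrite -(rmorph1 (@structm L A)) symbolC symbol0 vscaleE /vdelta eqxx mul1r.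
by apply/eqP; exact: oner_neq0.
Qed.

End Symbol.

(** * The injective endomorphism *)

Section GeometricSeries.
Context (L : comNzRingType) (I : finType) (s : I) (c : L).
Local Notation V := ({ffun I -> nat} -> L^o).

(* the geometric series sum_k c^k X^k in the s-th variable *)
Fact geom_proof :
  (fun (u : V) (e : {ffun I -> nat}) =>
    \sum_(k < (e s).+1) c ^+ k * u (upd s (e s - k) e)) \in @endo_pred L V.
Proof.
apply/asboolP => a u v; apply/funext => e; rewrite vaddE vscaleE mulr_sumr -big_split /=.
by apply: eq_bigr => k _; rewrite vaddE vscaleE mulrDr mulrCA.
Qed.
Definition geom : endo V := Endo geom_proof.

Lemma geomE (u : V) (e : {ffun I -> nat}) :
  geom u e = \sum_(k < (e s).+1) c ^+ k * u (upd s (e s - k) e).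
Proof. by []. Qed.

Lemma sub_shiftE (u : V) (e : {ffun I -> nat}) : (1 - structm c * shift L s : endo V) u e =
  u e - c * if (0 < e s)%N then u (upd s (e s).-1 e) else 0.
Proof. by rewrite endoB endoM endoC endo1 -shiftE. Qed.

Lemma sub_shift_geom : (1 - structm c * shift L s) * geom = 1.
Proof.
apply: endoP => u; apply/funext => e; rewrite endoM sub_shiftE endo1 !geomE.
rewrite big_ord_recl subn0 upd_id mul1r -addrA -[RHS]addr0; congr (_ + _).
apply/eqP; rewrite subr_eq0; apply/eqP; case: ltnP => [es|]; last first.
  by rewrite leqn0 => /eqP ->; rewrite big_ord0 mulr0.
rewrite upd_eq prednK // mulr_sumr; apply: eq_bigr => k _.
rewrite upd_upd exprS mulrA; congr (_ * u (upd s _ e)).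
by rewrite /= /bump /=; lia.
Qed.

(** In a series of the kernel each coefficient is [c] times the preceding one, and those with
    exponent 0 vanish. *)
Lemma sub_shift_inj0 (u : V) : (1 - structm c * shift L s : endo V) u = 0 -> u = 0.
Proof.
move=> Gu; apply/funext => e; have [k] := ubnP (e s); elim: k e => // k IHk e ek.
have /eqP := congr1 (fun v : V => v e) Gu.
rewrite sub_shiftE subr_eq0 => /eqP ->; case: ltnP => [es|_]; last by rewrite mulr0.
rewrite IHk ?mulr0 // upd_eq; lia.
Qed.

Lemma geom_sub_shift : geom * (1 - structm c * shift L s) = 1.
Proof.
apply: endoP => u; apply/eqP; rewrite -subr_eq0; apply/eqP/sub_shift_inj0.
set G := 1 - structm c * shift L s.
(* A right inverse of an injective operator is also a left inverse. *)
have E : G * (geom * G - 1) = 0 by rewrite mulrBr mulrA sub_shift_geom mul1r mulr1 subrr.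
by have := congr1 (fun f : endo V => f u) E; rewrite endoM endoB endo1.
Qed.

End GeometricSeries.

Lemma weyl_hom_ext (L : comNzRingType) (t : L) n (B : pzAlgType L) (g h : qweyl t n -> B) :
    alg_hom g -> alg_hom h -> (forall i, g (weyl_x t i) = h (weyl_x t i)) ->
    (forall i, g (weyl_d t i) = h (weyl_d t i)) -> g =1 h.
Proof.
move=> hg hh gx gd; elim/weyl_ind => [a b ga gb|c|i a ga|i a ga].
- by rewrite (alg_homD hg) (alg_homD hh) ga gb.
- by rewrite (alg_homC hg) (alg_homC hh).
- by rewrite (alg_homM hg) (alg_homM hh) ga gx.
- by rewrite (alg_homM hg) (alg_homM hh) ga gd.
Qed.

Section TwistedDerivation.
Context (R : pzRingType) (D X G J s : R).
Hypotheses (DX : D * X = s * X * D + 1) (sJ : s * J = J * s).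
Hypotheses (Gdef : G = 1 - (1 - s) * X) (JG : J * G = 1) (GJ : G * J = 1).
Hypothesis sX : s * X = X * s.

Lemma inv_comm a : a * G = G * a -> a * J = J * a.
Proof. by move=> aG; rewrite -[LHS]mul1r -JG -mulrA [G * _]mulrA -aG -mulrA GJ mulr1. Qed.

Lemma XJ : X * J = J * X.
Proof.
apply: inv_comm; rewrite Gdef mulrBr mulr1 [RHS]mulrBl mul1r; congr (_ - _).
by rewrite mulrA; congr (_ * _); rewrite mulrBr mulrBl mulr1 mul1r sX.
Qed.

(** By the choice of G, (D - 1) X = s X (D - 1) + G; then J cancels G and commutes with s X. *)
Lemma twisted_dx : J * (D - 1) * X = s * X * (J * (D - 1)) + 1.
Proof.
have -> : s * X * (J * (D - 1)) = J * (s * X * (D - 1)).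
  by rewrite -!mulrA [X * (J * _)]mulrA XJ -mulrA mulrA sJ -!mulrA.
rewrite -[in RHS]JG -mulrA -mulrDr; congr (_ * _).
rewrite JG mulrBl DX mul1r mulrBr mulr1 Gdef mulrBl mul1r opprB.
by rewrite -!addrA; congr (_ + _); rewrite [in RHS]addrCA addKr.
Qed.

(** With E = J (D - 1), the left side is E + (s - 1) X E + 1 = G E + 1. *)
Lemma twisted_add : J * (D - 1) + (J * (D - 1) * X - X * (J * (D - 1))) = D.
Proof.
set E := J * (D - 1).
have -> : E * X = s * X * E + 1 by exact: twisted_dx.
transitivity (G * E + 1); last by rewrite /E mulrA GJ mul1r subrK.
rewrite Gdef !mulrBl !mul1r opprB -!addrA; congr (_ + _).
by congr (_ + _); rewrite addrC.
Qed.

End TwistedDerivation.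

Section Twist.
Context (L : comNzRingType) (t : L) (n : nat) (i0 : 'I_n).
Local Notation A := (qweyl t n).
Local Notation V := ({ffun 'I_n + 'I_n -> nat} -> L^o).

Definition twist_d (i : 'I_n) : A :=
  if i == i0 then weyl_d t i + weyl_fi t i else weyl_d t i.

(** f_i satisfies the homogeneous form of the relation between d_i and x_j, so adding it to d_i
    preserves that relation. *)
Lemma twist_dx i j : twist_d i * weyl_x t j =
  structm (t ^+ (i == j)) * weyl_x t j * twist_d i + (i == j)%:R.
Proof.
rewrite /twist_d; case: ifP => _; last exact: weyl_dx.
by rewrite mulrDl mulrDr weyl_dx weyl_fi_x mulrA addrAC.
Qed.

Lemma twist_dd i j : twist_d i * twist_d j = twist_d j * twist_d i.
Proof.
have fd k l : k != l -> weyl_fi t k * weyl_d t l = weyl_d t l * weyl_fi t k.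
  by move=> /negPf kl; rewrite weyl_fi_d kl expr0 rmorph1 mul1r.
rewrite /twist_d; case: eqVneq => [->|ii]; case: eqVneq => [->|jj] //.
- by rewrite mulrDl mulrDr weyl_dd fd // eq_sym.
- by rewrite mulrDl mulrDr weyl_dd fd // eq_sym.
- exact: weyl_dd.
Qed.

Definition twist : A -> A := weyl_lift (weyl_x t (n := n)) twist_d.

Lemma twist_hom : alg_hom twist.
Proof. exact: weyl_lift_hom twist_dx (@weyl_xx _ t n) twist_dd. Qed.
Lemma twist_weyl_x i : twist (weyl_x t i) = weyl_x t i.
Proof. exact: weyl_lift_x twist_dx (@weyl_xx _ t n) twist_dd i. Qed.
Lemma twist_weyl_d i : twist (weyl_d t i) = twist_d i.
Proof. exact: weyl_lift_d twist_dx (@weyl_xx _ t n) twist_dd i. Qed.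

Let J : endo V := geom (inl i0) (1 - t).
Let G : endo V := 1 - structm (1 - t) * rep_x L i0.

Definition untwist_d (i : 'I_n) : endo V :=
  if i == i0 then J * (rep_d t i - 1) else rep_d t i.

Lemma untwist_GE : G = 1 - (1 - structm t) * rep_x L i0.
Proof. by rewrite /G rmorphB rmorph1. Qed.

Lemma untwist_inv_comm a : a * rep_x L i0 = rep_x L i0 * a -> a * J = J * a.
Proof.
move=> ax; apply: (@inv_comm _ G); [exact: geom_sub_shift|exact: sub_shift_geom|].
by rewrite /G mulrBl mulrBr mulr1 mul1r mulrA -structm_central -mulrA ax !mulrA.
Qed.

Lemma rep_dx_neq (i j : 'I_n) : i != j -> rep_d t i * rep_x L j = rep_x L j * rep_d t i.
Proof. by move=> /negPf ij; rewrite rep_dx ij expr0 rmorph1 mul1r addr0. Qed.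

Lemma untwist_dx i j : untwist_d i * rep_x L j =
  structm (t ^+ (i == j)) * rep_x L j * untwist_d i + (i == j)%:R.
Proof.
rewrite /untwist_d; case: eqVneq => [->|_]; last exact: rep_dx.
case: eqVneq => [<-|ij].
  rewrite expr1; apply: (twisted_dx _ _ untwist_GE).
  - by rewrite rep_dx eqxx expr1.
  - exact: structm_central.
  - exact: geom_sub_shift.
  - exact: sub_shift_geom.
  - exact: structm_central.
rewrite expr0 rmorph1 mul1r addr0 -mulrA mulrBl mul1r rep_dx_neq //.
rewrite -[X in _ - X]mulr1 -mulrBr !mulrA untwist_inv_comm //; exact: rep_xx.
Qed.

Lemma untwist_dd i j : untwist_d i * untwist_d j = untwist_d j * untwist_d i.
Proof.
have dJ k : k != i0 -> rep_d t k * (J * (rep_d t i0 - 1)) = J * (rep_d t i0 - 1) * rep_d t k.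
  move=> ki; rewrite mulrA untwist_inv_comm ?rep_dx_neq // -!mulrA.
  by rewrite mulrBr mulrBl mulr1 mul1r rep_dd.
rewrite /untwist_d; case: eqVneq => [->|ii]; case: eqVneq => [->|jj] //.
- by rewrite dJ.
- by rewrite dJ.
- exact: rep_dd.
Qed.

Definition untwist : A -> endo V := weyl_lift (rep_x L (n := n)) untwist_d.

Lemma untwist_hom : alg_hom untwist.
Proof. exact: weyl_lift_hom untwist_dx (@rep_xx _ n) untwist_dd. Qed.
Lemma untwist_weyl_x i : untwist (weyl_x t i) = rep_x L i.
Proof. exact: weyl_lift_x untwist_dx (@rep_xx _ n) untwist_dd i. Qed.
Lemma untwist_weyl_d i : untwist (weyl_d t i) = untwist_d i.
Proof. exact: weyl_lift_d untwist_dx (@rep_xx _ n) untwist_dd i. Qed.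

Lemma untwist_twist : untwist \o twist =1 rep (t := t) (n := n).
Proof.
apply: weyl_hom_ext.
- exact: alg_hom_comp untwist_hom twist_hom.
- exact: rep_hom.
- by move=> i; rewrite /= twist_weyl_x untwist_weyl_x rep_weyl_x.
move=> i; rewrite /= twist_weyl_d rep_weyl_d /twist_d.
case: eqVneq => [->|ii]; last by rewrite untwist_weyl_d /untwist_d (negPf ii).
rewrite (alg_homD untwist_hom) (alg_homB untwist_hom) !(alg_homM untwist_hom).
rewrite untwist_weyl_x untwist_weyl_d /untwist_d eqxx.
apply: (twisted_add _ _ untwist_GE).
- by rewrite rep_dx eqxx expr1.
- exact: structm_central.
- exact: geom_sub_shift.
- exact: sub_shift_geom.
- exact: structm_central.
Qed.

Lemma twist_inj : injective twist.
Proof.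
move=> a b tab; apply/eqP; rewrite -subr_eq0; apply/eqP/(@symbol_inj0 _ t n).
rewrite /symbol -untwist_twist /= (alg_homB twist_hom) tab subrr.
by rewrite (alg_hom0 untwist_hom).
Qed.

End Twist.

(** * Non-surjectivity *)

HB.instance Definition _ (F : comNzRingType) (m : nat) :=
  isPzAlgebra.Build F 'M[F]_m (raddfB (@scalar_mx F m))
    (@scalar_mx_is_monoid_morphism F m) (fun c M => esym (scalar_mxC c M)).

Section MatrixRepresentation.
Context (L : comNzRingType) (F : fieldType) (ev : {rmorphism L -> F}) (t : L).
Context (n : nat) (i0 : 'I_n).
Local Notation q := (ev t).
Hypotheses (q_neq0 : q != 0) (q_neq1 : q != 1).
Local Notation A := (qweyl t n).
Local Notation B := (restrict_scalars ev 'M[F]_2).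

Let lam : F := (1 - q)^-1.

(** The relation between d and x when x acts as 1 and d as [lam]. *)
Lemma lamE : lam = q * lam + 1.
Proof.
have : (1 - q) * lam = 1 by rewrite divff // subr_eq0 eq_sym.
by rewrite mulrBl mul1r => /eqP; rewrite subr_eq addrC => /eqP.
Qed.

(** The eigenvalues of x are in the ratio q, which leaves the lower left entry c of d unconstrained.
    The commutator of d and x then has the entry -c there, so adding it makes d diagonal; c = 1 is
    taken. *)
Definition mx_x0 : 'M[F]_2 := \matrix_(k, l)
  (if k == l then (if k == 0 then q * lam else lam) else 0).
Definition mx_d0 : 'M[F]_2 := \matrix_(k, l)
  (if k == 0 then (if l == 0 then q^-1 else 0) else 1).

Lemma mx_dx0 : mx_d0 * mx_x0 = q%:M * mx_x0 * mx_d0 + 1.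
Proof.
have e k l : (q%:M * mx_x0) k l = q * mx_x0 k l.
  by rewrite -[_ * _]/(_ *m _) mul_scalar_mx mxE.
apply/matrixP => k l; rewrite mxE [RHS]mxE [X in X + _]mxE !big_ord_recl !big_ord0 !addr0 !e.
rewrite !mxE; case: k => [[|[|//]]] ?; case: l => [[|[|//]]] ? /=;
  rewrite !(mulr0, mul0r, addr0, add0r, mulr1, mul1r) //.
- by rewrite mulrA mulVf // mul1r mulrAC divff // mul1r; exact: lamE.
- exact: lamE.
Qed.

Definition mx_x (i : 'I_n) : B := if i == i0 then mx_x0 else 1.
Definition mx_d (i : 'I_n) : B := if i == i0 then mx_d0 else lam%:M.

Lemma mx_structm (c : L) : structm c = (ev c)%:M :> B. Proof. by []. Qed.

Lemma mx_dx i j : mx_d i * mx_x j =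
  structm (t ^+ (i == j)) * mx_x j * mx_d i + (i == j)%:R.
Proof.
have lamC (M : B) : (lam%:M : B) * M = M * lam%:M by exact/esym/scalar_mxC.
rewrite /mx_d /mx_x; have [->|ii] := eqVneq i i0; have [jE|jj] := eqVneq j i0; rewrite ?jE.
- by rewrite expr1 mx_structm; exact: mx_dx0.
- by rewrite expr0 rmorph1 !mulr1 mul1r addr0.
- by rewrite (negPf ii) expr0 rmorph1 mul1r addr0 lamC.
have [_|_] := eqVneq i j; last by rewrite expr0 rmorph1 !mulr1 mul1r addr0.
rewrite expr1 !mulr1 mx_structm -[q%:M * _]/(_ *m _) -scalar_mxM.
by rewrite -[1]/(1%:M) -raddfD -lamE.
Qed.

Lemma mx_xx i j : mx_x i * mx_x j = mx_x j * mx_x i.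
Proof. by rewrite /mx_x; do 2!case: ifP => _; rewrite ?mulr1 ?mul1r. Qed.

Lemma mx_dd i j : mx_d i * mx_d j = mx_d j * mx_d i.
Proof.
have lamC (M : B) : (lam%:M : B) * M = M * lam%:M by exact/esym/scalar_mxC.
by rewrite /mx_d; do 2!case: ifP => _; rewrite // lamC.
Qed.

Definition mx_rep : A -> B := weyl_lift mx_x mx_d.

Lemma mx_rep_hom : alg_hom mx_rep.
Proof. exact: weyl_lift_hom mx_dx mx_xx mx_dd. Qed.
Lemma mx_rep_x i : mx_rep (weyl_x t i) = mx_x i.
Proof. exact: weyl_lift_x mx_dx mx_xx mx_dd i. Qed.
Lemma mx_rep_d i : mx_rep (weyl_d t i) = mx_d i.
Proof. exact: weyl_lift_d mx_dx mx_xx mx_dd i. Qed.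

Local Notation upper M := ((M : 'M[F]_2) 1 0 == 0).

Lemma upper_mul (M N : B) : upper M -> upper N -> upper (M * N).
Proof.
move=> /eqP M0 /eqP N0; rewrite mxE !big_ord_recl big_ord0 addr0.
rewrite (_ : ord0 = 0) // (_ : lift 0 0 = 1); last exact/val_inj.
by rewrite M0 N0 mul0r mulr0 addr0.
Qed.

(** Upper triangular matrices form a subalgebra, so the generators suffice. The matrix of d itself
    lies outside this subalgebra. *)
Lemma upper_twist (a : A) : upper (mx_rep (twist i0 a)).
Proof.
have H : alg_hom (mx_rep \o @twist _ t _ i0) by apply: alg_hom_comp mx_rep_hom (twist_hom _ i0).
rewrite -[mx_rep _]/((mx_rep \o @twist _ t _ i0) a).
elim/weyl_ind: a => [a b|c|i a la|i a la].
- by rewrite (alg_homD H) mxE => /eqP -> /eqP ->; rewrite addr0.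
- by rewrite (alg_homC H) mx_structm mxE.
- rewrite (alg_homM H); apply: upper_mul la.
  rewrite /= twist_weyl_x mx_rep_x /mx_x.
  by case: ifP => _; rewrite !mxE.
- rewrite (alg_homM H); apply: upper_mul la.
  rewrite /= twist_weyl_d /twist_d; have [->|ii] := eqVneq i i0; last first.
    by rewrite mx_rep_d /mx_d (negPf ii) mxE.
  rewrite (alg_homD mx_rep_hom) (alg_homB mx_rep_hom) !(alg_homM mx_rep_hom).
  rewrite mx_rep_x mx_rep_d /mx_x /mx_d eqxx !mxE !big_ord_recl !big_ord0 !addr0 !mxE /=.
  rewrite !(mulr0, mul0r, addr0, add0r, mulr1, mul1r).
  (* The remaining entry is 1 from d plus [q * lam - lam], that is -1, from the commutator. *)
  have /eqP := lamE; rewrite addrC -subr_eq => /eqP e.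
  by rewrite -e addrAC subrK subrr.
Qed.

Lemma twist_not_surj : ~ surjective (@twist _ t _ i0).
Proof.
move=> /(_ (weyl_d t i0))[a ad]; have := upper_twist a.
by rewrite ad mx_rep_d /mx_d eqxx mxE /= oner_eq0.
Qed.

(** The eigenvalues [q * lam] and [lam] of x differ by 1. *)
Lemma weyl_x_not_scalar c : weyl_x t i0 <> structm c.
Proof.
move=> /(congr1 mx_rep); rewrite mx_rep_x (alg_homC mx_rep_hom) /mx_x eqxx.
move=> /matrixP e; have := e 0 0; have := e 1 1; rewrite !mxE /= mulr1n => e1 e0.
by have := lamE; rewrite e0 e1 => /eqP; rewrite -subr_eq0 opprD addrA subrr add0r oppr_eq0 oner_eq0.
Qed.

End MatrixRepresentation.

(** * A character as an endomorphism *)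

Section Collapse.
Context (F : fieldType) (q : F) (n : nat) (i0 : 'I_n).
Hypotheses (q_neq0 : q != 0) (q_neq1 : q != 1).
Local Notation A := (qweyl q n).

Let collapse_dx (i j : 'I_n) : structm (1 - q)^-1 * 1 =
  structm (q ^+ (i == j)) * 1 * structm (1 - q)^-1 + (i == j)%:R :> A.
Proof.
case: (i == j); last by rewrite expr0 rmorph1 !mulr1 mul1r addr0.
by rewrite expr1 !mulr1 -rmorphM -(rmorph1 (@structm F A)) -rmorphD -(lamE (ev := idfun)).
Qed.

Definition collapse : A -> A :=
  weyl_lift (fun=> 1) (fun=> structm (1 - q)^-1).

Lemma collapse_hom : alg_hom collapse.
Proof. exact: weyl_lift_hom collapse_dx (fun _ _ => erefl) (fun _ _ => erefl). Qed.

Lemma collapse_scalar a : exists c, collapse a = structm c.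
Proof.
have hx i : collapse (weyl_x q i) = 1.
  exact: weyl_lift_x collapse_dx (fun _ _ => erefl) (fun _ _ => erefl) i.
have hd i : collapse (weyl_d q i) = structm (1 - q)^-1.
  exact: weyl_lift_d collapse_dx (fun _ _ => erefl) (fun _ _ => erefl) i.
elim/weyl_ind: a => [a b [c ca] [d db]|c|i a [c ca]|i a [c ca]].
- by exists (c + d); rewrite (alg_homD collapse_hom) ca db rmorphD.
- by exists c; rewrite (alg_homC collapse_hom).
- by exists c; rewrite (alg_homM collapse_hom) hx mul1r.
- by exists ((1 - q)^-1 * c); rewrite (alg_homM collapse_hom) hd ca rmorphM.
Qed.

Lemma collapse_not_surj : ~ surjective collapse.
Proof.
move=> /(_ (weyl_x q i0))[a ax]; have [c ac] := collapse_scalar a.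
by apply: (@weyl_x_not_scalar _ _ idfun q _ i0 q_neq0 q_neq1 c); rewrite -ax.
Qed.

Lemma collapse_not_inj : ~ injective collapse.
Proof.
(* x and 1 have the same image 1, so injectivity would make x a scalar. *)
move=> inj; apply: (@weyl_x_not_scalar _ _ idfun q _ i0 q_neq0 q_neq1 1).
rewrite rmorph1; apply: inj; rewrite (alg_hom1 collapse_hom).
exact: weyl_lift_x collapse_dx (fun _ _ => erefl) (fun _ _ => erefl) i0.
Qed.

End Collapse.

(** * Specialization of the parameter *)

Lemma laurent_fraction (F : fieldType) (u : laurent F) :
  exists pk : {poly F} * nat, laurent_val u = tofrac pk.1 / tofrac 'X ^+ pk.2.
Proof. by case: u => u /= /laurent_predP[p [k ->]]; exists (p, k). Qed.

(** A fraction is chosen by [cid]; by [laurent_evalE] the value does not depend on it. The proof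
    that q is nonzero is an argument so that a ring morphism structure can be attached. *)
HB.lock Definition laurent_eval (F : fieldType) (q : F) (q_neq0 : q != 0)
    (u : laurent F) : F :=
  let pk := projT1 (cid (laurent_fraction u)) in pk.1.[q] / q ^+ pk.2.

Section LaurentEvaluation.
Context (F : fieldType) (q : F) (q_neq0 : q != 0).
Local Notation ev := (laurent_eval q_neq0).

Lemma laurent_frac_inj (p r : {poly F}) k l :
  tofrac p / tofrac 'X ^+ k = tofrac r / tofrac 'X ^+ l -> p * 'X^l = r * 'X^k.
Proof.
move=> /eqP; rewrite eqr_div ?tofracX_neq0 // -!tofracXn -!tofracM tofrac_eq.
by move=> /eqP.
Qed.

Lemma laurent_evalE (u : laurent F) p k :
  laurent_val u = tofrac p / tofrac 'X ^+ k -> ev u = p.[q] / q ^+ k.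
Proof.
rewrite laurent_eval.unlock; case: cid => -[r l] /= -> /laurent_frac_inj.
move=> /(congr1 (fun f => f.[q])); rewrite !hornerM !hornerXn => e.
by apply/eqP; rewrite eqr_div ?expf_neq0 // e.
Qed.

Fact laurent_eval_zmod : zmod_morphism ev.
Proof.
move=> u v; have [[p k] /= pu] := laurent_fraction u.
have [[r l] /= rv] := laurent_fraction v.
rewrite (laurent_evalE pu) (laurent_evalE rv).
rewrite (@laurent_evalE _ (p * 'X^l - r * 'X^k) (k + l)).
  rewrite hornerD hornerN !hornerM !hornerXn exprD mulrBl !invfM; congr (_ - _).
    by rewrite mulrACA divff ?mulr1 ?expf_neq0.
  by rewrite [q ^- k * _]mulrC mulrACA divff ?mulr1 ?expf_neq0.
rewrite /= pu rv tofracB !tofracM !tofracXn exprD mulrBl !invfM.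
congr (_ - _); first by rewrite mulrACA divff ?mulr1 ?tofracX_neq0.
by rewrite [_ ^- k * _]mulrC mulrACA divff ?mulr1 ?tofracX_neq0.
Qed.

Lemma laurent_eval_const c : ev (laurent_const c) = c.
Proof. by rewrite (@laurent_evalE _ c%:P 0) /= ?hornerC ?divr1. Qed.

Lemma laurent_eval_t : ev (laurent_t F) = q.
Proof. by rewrite (@laurent_evalE _ 'X 0) /= ?hornerX ?divr1. Qed.

Fact laurent_eval_monoid : monoid_morphism ev.
Proof.
split=> [|u v]; first by rewrite -(rmorph1 (@laurent_const F)) laurent_eval_const.
have [[p k] /= pu] := laurent_fraction u; have [[r l] /= rv] := laurent_fraction v.
rewrite (laurent_evalE pu) (laurent_evalE rv) (@laurent_evalE _ (p * r) (k + l)).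
  by rewrite hornerM exprD invfM mulrACA.
by rewrite /= pu rv tofracM exprD invfM mulrACA.
Qed.

HB.instance Definition _ :=
  GRing.isZmodMorphism.Build (laurent F) F ev laurent_eval_zmod.
HB.instance Definition _ :=
  GRing.isMonoidMorphism.Build (laurent F) F ev laurent_eval_monoid.

Local Notation tq := (laurent_t F - laurent_const q).

Lemma laurent_valM (u v : laurent F) :
  laurent_val (u * v) = laurent_val u * laurent_val v.
Proof. by []. Qed.

Lemma laurent_valX (u : laurent F) k : laurent_val (u ^+ k) = laurent_val u ^+ k.
Proof. by elim: k => // k IHk; rewrite !exprS laurent_valM IHk. Qed.

Lemma laurent_val_tq : laurent_val tq = tofrac ('X - q%:P).
Proof. by rewrite /= tofracB. Qed.

Lemma laurent_tq_regular u : tq * u = 0 -> u = 0.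
Proof.
move=> /(congr1 (@laurent_val F)); rewrite laurent_valM laurent_val_tq => /eqP.
rewrite mulf_eq0 tofrac_eq0 polyXsubC_eq0 /= => /eqP u0; exact/val_inj.
Qed.

(** By the factor theorem t - q divides the numerator, as the denominator does not vanish at q. *)
Lemma laurent_eval_ker u : ev u = 0 -> exists v, u = tq * v.
Proof.
have [[p k] /= pu] := laurent_fraction u; rewrite (laurent_evalE pu) => /eqP.
rewrite mulf_eq0 invr_eq0 expf_eq0 (negPf q_neq0) andbF orbF => /factor_theorem[r pr].
have rP : tofrac r / tofrac 'X ^+ k \in @laurent_pred F by apply/laurent_predP; exists r, k.
exists (Laurent rP); apply/val_inj.
by rewrite [RHS]laurent_valM laurent_val_tq /= pu pr tofracM mulrA [tofrac r * _]mulrC.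
Qed.

(** Write u = p / X^k. As X - q is coprime to X, all its powers divide p; the power with exponent
    [size p] has too large a degree unless p = 0. *)
Lemma laurent_tq_separated u : (forall k, exists v, u = tq ^+ k * v) -> u = 0.
Proof.
move=> uk; have [[p k] /= pu] := laurent_fraction u.
suff p0 : p = 0 by apply/val_inj; rewrite /= pu p0 tofrac0 mul0r.
apply/eqP; apply: contraT => p0.
have [v uv] := uk (size p); have [[r l] /= rv] := laurent_fraction v.
have : ('X - q%:P) ^+ size p %| p.
  have cop : coprimep (('X - q%:P) ^+ size p) ('X^l).
    apply/coprimep_expl/coprimep_expr; rewrite coprimep_sym coprimep_XsubC.
    by rewrite /root hornerX.
  rewrite -(Gauss_dvdpl _ cop) (@laurent_frac_inj p (('X - q%:P) ^+ size p * r) k l).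
    by rewrite -mulrA dvdp_mulr.
  rewrite -pu uv tofracM -mulrA -rv tofracXn -laurent_val_tq.
  by rewrite laurent_valM laurent_valX.
move=> /(dvdp_leq p0); rewrite size_exp_XsubC; by rewrite ltnn.
Qed.

End LaurentEvaluation.

(** * The quotient by t - q as a quantized Weyl algebra over the field *)

Section WeylSpecialization.
Context (F : fieldType) (n : nat) (q : F) (q_neq0 : q != 0).
Local Notation ev := (laurent_eval q_neq0).
Local Notation B := (restrict_scalars ev (qweyl q n)).

Let X (i : 'I_n) : B := weyl_x q i.
Let D (i : 'I_n) : B := weyl_d q i.

Lemma specialize_dx (i j : 'I_n) :
  D i * X j = structm (laurent_t F ^+ (i == j)) * X j * D i + (i == j)%:R.
Proof.
have E : ev (laurent_t F ^+ (i == j)) = q ^+ (i == j) by rewrite rmorphXn /= laurent_eval_t.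
by rewrite -[structm _]/(@structm F (qweyl q n) (ev _)) E; exact: weyl_dx.
Qed.

Let XX i j : X i * X j = X j * X i. Proof. exact: weyl_xx. Qed.
Let DD i j : D i * D j = D j * D i. Proof. exact: weyl_dd. Qed.

Definition specialize : weyl_t F n -> B := weyl_lift X D.

Lemma specialize_hom : alg_hom specialize.
Proof. exact: weyl_lift_hom specialize_dx XX DD. Qed.
Lemma specialize_x i : specialize (weyl_x _ i) = X i.
Proof. exact: weyl_lift_x specialize_dx XX DD i. Qed.
Lemma specialize_d i : specialize (weyl_d _ i) = D i.
Proof. exact: weyl_lift_d specialize_dx XX DD i. Qed.

Lemma specialize_rel a : weyl_q_rel q a -> specialize a = 0.
Proof.
case; rewrite (alg_homC specialize_hom).
have E : ev (laurent_t F - laurent_const q) = 0.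
  by rewrite rmorphB /= laurent_eval_t laurent_eval_const subrr.
by rewrite -[structm _]/(@structm F (qweyl q n) (ev _)) E rmorph0.
Qed.

Definition weyl_q_to : weyl_q F n q -> qweyl q n := quot_lift specialize.

Lemma weyl_q_toE a : weyl_q_to (weyl_q_pi q a) = specialize a.
Proof. exact: quot_liftE specialize_hom specialize_rel a. Qed.

Lemma weyl_q_to_hom : alg_hom weyl_q_to.
Proof.
have [hB hM hC] := quot_lift_hom specialize_hom specialize_rel.
split=> // c; rewrite -[LHS]/(quot_lift specialize (structm (laurent_const c))) hC.
by rewrite -[LHS]/(structm (ev _)) laurent_eval_const.
Qed.

Let Xq (i : 'I_n) : weyl_q F n q := weyl_q_pi q (weyl_x (laurent_t F) i).
Let Dq (i : 'I_n) : weyl_q F n q := weyl_q_pi q (weyl_d (laurent_t F) i).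
Local Notation pi_hom := (quot_pi_hom (@weyl_q_rel F n q)).

Lemma weyl_q_dx i j :
  Dq i * Xq j = structm (q ^+ (i == j)) * Xq j * Dq i + (i == j)%:R.
Proof.
have := congr1 (weyl_q_pi q) (weyl_dx (laurent_t F) i j).
rewrite [LHS](alg_homM pi_hom) => ->.
rewrite [LHS](alg_homD pi_hom) !(alg_homM pi_hom); congr (_ * _ * _ + _).
  rewrite !rmorphXn (alg_homX pi_hom); congr (_ ^+ _); exact: weyl_q_t.
by case: (i == j); [exact: (alg_hom1 pi_hom) | exact: (alg_hom0 pi_hom)].
Qed.

Lemma weyl_q_xx i j : Xq i * Xq j = Xq j * Xq i.
Proof.
have := congr1 (weyl_q_pi q) (weyl_xx (laurent_t F) i j).
by rewrite [LHS](alg_homM pi_hom) [RHS](alg_homM pi_hom).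
Qed.

Lemma weyl_q_dd i j : Dq i * Dq j = Dq j * Dq i.
Proof.
have := congr1 (weyl_q_pi q) (weyl_dd (laurent_t F) i j).
by rewrite [LHS](alg_homM pi_hom) [RHS](alg_homM pi_hom).
Qed.

Definition weyl_q_of : qweyl q n -> weyl_q F n q := weyl_lift Xq Dq.

Lemma weyl_q_of_hom : alg_hom weyl_q_of.
Proof. exact: weyl_lift_hom weyl_q_dx weyl_q_xx weyl_q_dd. Qed.
Lemma weyl_q_of_x i : weyl_q_of (weyl_x q i) = Xq i.
Proof. exact: weyl_lift_x weyl_q_dx weyl_q_xx weyl_q_dd i. Qed.
Lemma weyl_q_of_d i : weyl_q_of (weyl_d q i) = Dq i.
Proof. exact: weyl_lift_d weyl_q_dx weyl_q_xx weyl_q_dd i. Qed.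

Lemma weyl_q_ofK : cancel weyl_q_of weyl_q_to.
Proof.
apply: (@weyl_hom_ext _ _ _ _ (weyl_q_to \o weyl_q_of) id).
- exact: alg_hom_comp weyl_q_to_hom weyl_q_of_hom.
- exact: alg_hom_id.
- by move=> i; rewrite /= weyl_q_of_x weyl_q_toE specialize_x.
- by move=> i; rewrite /= weyl_q_of_d weyl_q_toE specialize_d.
Qed.

Lemma weyl_q_of_specialize a : weyl_q_of (specialize a) = weyl_q_pi q a.
Proof.
elim/weyl_ind: a => [a b ha hb|c|i a ha|i a ha].
- rewrite (alg_homD specialize_hom) (alg_homD weyl_q_of_hom) ha hb.
  by rewrite [RHS](alg_homD pi_hom).
- rewrite (alg_homC specialize_hom) -[structm c]/(structm (ev c)) (alg_homC weyl_q_of_hom).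
  rewrite weyl_q_structm; apply/eqP; rewrite eq_sym -subr_eq0 -(alg_homB pi_hom) -rmorphB.
  (* [c] and its value at q differ by a multiple of t - q, which is zero in the quotient. *)
  have [|v ->] := @laurent_eval_ker F q q_neq0 (c - laurent_const (ev c)).
    by rewrite rmorphB /= laurent_eval_const subrr.
  rewrite rmorphM (alg_homM pi_hom) (quot_pi_eq0 (WeylQRel n q)) mul0r //.
- rewrite (alg_homM specialize_hom) (alg_homM weyl_q_of_hom) ha specialize_x.
  by rewrite weyl_q_of_x [RHS](alg_homM pi_hom).
- rewrite (alg_homM specialize_hom) (alg_homM weyl_q_of_hom) ha specialize_d.
  by rewrite weyl_q_of_d [RHS](alg_homM pi_hom).
Qed.

Lemma weyl_q_toK : cancel weyl_q_to weyl_q_of.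
Proof.
move=> z; have [a <-] := quot_pi_surj z.
by rewrite -[quot_pi _ a]/(weyl_q_pi q a) weyl_q_toE weyl_q_of_specialize.
Qed.

(** An element killed by [specialize] is zero in the quotient by t - q; as t - q is central, the
    two-sided ideal it generates consists of its multiples. *)
Lemma specialize_ker a : specialize a = 0 ->
  exists b, a = structm (laurent_t F - laurent_const q) * b.
Proof.
move=> sa; have : weyl_q_pi q a = weyl_q_pi q 0.
  by rewrite -!weyl_q_of_specialize sa (alg_hom0 specialize_hom).
move=> /quot_piP; rewrite subr0.
elim=> {a sa} [a []||a b _ [a' ->] _ [b' ->]|a b c _ [b' ->]].
- by exists 1; rewrite mulr1.
- by exists 0; rewrite mulr0.
- by exists (a' + b'); rewrite mulrDr.
- by exists (a * b' * c); rewrite !mulrA structm_central.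
Qed.

End WeylSpecialization.

(** * Simplicity at t = 1 *)

Section Commutant.
Context (L : comNzRingType) (t : L) (n : nat).
Local Notation I := ('I_n + 'I_n)%type.
Local Notation V := ({ffun I -> nat} -> L^o).

Lemma rep_commutant (f : endo V) :
    (forall i, rep_x L i * f = f * rep_x L i) ->
    (forall i, rep_d t i * f = f * rep_d t i) ->
  forall a : qweyl t n, rep a * f = f * rep a.
Proof.
move=> fx fd; have H := @rep_hom _ t n.
elim/weyl_ind => [a b ha hb|c|i a ha|i a ha].
- by rewrite (alg_homD H) mulrDl mulrDr ha hb.
- by rewrite (alg_homC H) structm_central.
- by rewrite (alg_homM H) rep_weyl_x -mulrA ha mulrA fx mulrA.
- by rewrite (alg_homM H) rep_weyl_d -mulrA ha mulrA fd mulrA.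
Qed.

(** The symbol is the action on the series 1, and [f] commutes with all left multiplications: rep a
    (f 1) = f (rep a 1). *)
Lemma symbolMr (f : endo V) (a b : qweyl t n) :
    (forall i, rep_x L i * f = f * rep_x L i) ->
    (forall i, rep_d t i * f = f * rep_d t i) ->
  symbol b = f (vdelta L [ffun => 0%N]) -> symbol (a * b) = f (symbol a).
Proof. by move=> fx fd sb; rewrite symbolM sb -!endoM rep_commutant. Qed.

Lemma symbol_weyl_x (i : 'I_n) : symbol (weyl_x t i) = shift L (inl i) (vdelta L [ffun => 0%N]).
Proof. by rewrite /symbol rep_weyl_x. Qed.

Lemma symbol_weyl_d (i : 'I_n) : symbol (weyl_d t i) = shift L (inr i) (vdelta L [ffun => 0%N]).
Proof.
rewrite /symbol rep_weyl_d endoD endoM qder_vdelta ?ffunE // addr0 shift_vdelta.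
by rewrite qscale_vdelta incr_neq // ffunE expr0 scale1r.
Qed.

Lemma symbol_mulr_d i (a : qweyl t n) :
  symbol (a * weyl_d t i) = shift L (inr i) (symbol a).
Proof.
apply: symbolMr => [j|j|]; first exact: shift_comm.
  exact: rep_d_shift.
exact: symbol_weyl_d.
Qed.

End Commutant.

Section WeylSimplicity.
Context (F : fieldType) (n : nat).
Hypothesis char0 : [pchar F] =i pred0.
Local Notation I := ('I_n + 'I_n)%type.
Local Notation A := (qweyl (1 : F) n).
Local Notation V := ({ffun I -> nat} -> F^o).
Local Notation sh := (shift F).
Local Notation der := (qder (1 : F)).

Lemma qnum1 k : qnum (1 : F) k = k%:R.
Proof. by elim: k => //= k ->; rewrite mul1r -mulrS. Qed.

Lemma qscale1 (s : I) : qscale (1 : F) s = 1.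
Proof. by apply: endoP => u; apply/funext => e; rewrite qscaleE expr1n mul1r. Qed.

Lemma rep_d1 (i : 'I_n) : rep_d (1 : F) i = sh (inr i) + der (inl i) :> endo V.
Proof. by rewrite /rep_d qscale1 mul1r. Qed.

Lemma der_shift s : der s * sh s = sh s * der s + 1 :> endo V.
Proof. by rewrite qder_shift rmorph1 mul1r. Qed.

(* On symbols, right multiplication by x_i is X + d/dY, as it commutes with *)
(* left multiplications and agrees with x_i on the symbol of 1.             *)
Lemma symbol_mulr_x i (a : A) :
  symbol (a * weyl_x 1 i) = (sh (inl i) + der (inr i) : endo V) (symbol a).
Proof.
apply: symbolMr => [j|j|].
- by apply: commrD; [exact: shift_comm|exact: coord_op_comm].
- rewrite rep_d1; have [<-|ij] := eqVneq i j; last first.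
    have ll : inl j != inl i :> I by apply: contra ij => /eqP[->].
    have rr : inr j != inr i :> I by apply: contra ij => /eqP[->].
    by apply/commrD; apply/commr_sym/commrD; apply/commr_sym; exact: coord_op_comm.
  rewrite !mulrDl !mulrDr der_shift [der (inr i) * sh _]der_shift.
  rewrite (@coord_op_comm _ _ (inr i) (inl i)) // (@coord_op_comm _ _ (inl i) (inr i)) //.
  rewrite -!addrA; congr (_ + _).
  by rewrite addrCA; do 3!congr (_ + _); exact: coord_op_comm.
- by rewrite symbol_weyl_x endoD qder_vdelta ?ffunE // addr0.
Qed.

Lemma symbol_comm_d i (a : A) :
  symbol (weyl_d 1 i * a - a * weyl_d 1 i) = der (inl i) (symbol a).
Proof.
by rewrite symbolB symbolM symbol_mulr_d rep_weyl_d rep_d1 endoD addrC addKr.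
Qed.

Lemma symbol_comm_x i (a : A) :
  symbol (a * weyl_x 1 i - weyl_x 1 i * a) = der (inr i) (symbol a).
Proof.
by rewrite symbolB symbol_mulr_x symbolM rep_weyl_x endoD addrC addKr.
Qed.

(** The kernel is stable under commutators, hence under differentiation of symbols, which lowers the
    degree. By induction all first derivatives of the symbol of [a] vanish; in characteristic 0 this
    makes [a] a scalar, and a unital map to a nonzero algebra is injective on scalars. *)
Lemma weyl_simple (B : pzAlgType F) (g : A -> B) : 1 != 0 :> B -> alg_hom g ->
  forall a, g a = 0 -> a = 0.
Proof.
move=> B1 hg a ga; apply: symbol_inj0; have [k ak] := symbol_bounded a.
have {ak}: forall e, (k < mdeg e)%N -> symbol a e = 0 by [].
(* Induction on a strict bound of the degree: for the bound 0 every coefficient vanishes. *)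
elim: k.+1 a ga => {k} [a _ ak|k IHk a ga ak]; first by apply/funext => e; exact: ak.
have IHd s b : symbol b = der s (symbol a) -> g b = 0 -> forall e, symbol a (incr s e) = 0.
  move=> sb gb e; have /IHk : forall e, (k <= mdeg e)%N -> symbol b e = 0.
    by move=> e' ke'; rewrite sb qderE ak ?mulr0 // mdeg_incr.
  move=> /(_ gb)/(congr1 (fun u : V => u e)); rewrite sb qderE qnum1 => /eqP.
  by rewrite mulf_eq0 (pcharf0P _).1 //= => /eqP.
have a_incr s e : symbol a (incr s e) = 0.
  case: s => i.
    apply: IHd (symbol_comm_d i a) _ e.
    by rewrite (alg_homB hg) !(alg_homM hg) ga mulr0 mul0r subrr.
  apply: IHd (symbol_comm_x i a) _ e.
  by rewrite (alg_homB hg) !(alg_homM hg) ga mulr0 mul0r subrr.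
pose c := symbol a [ffun => 0%N].
have sa : symbol a = symbol (structm c : A).
  apply/funext => e; rewrite symbolC vscaleE /vdelta.
  have [->|e0] := eqVneq e [ffun => 0%N]; first by rewrite mulr1.
  have [/mdeg_eq0 ee|/mdeg_gt0[s es]] := eqVneq (mdeg e) 0%N.
    by rewrite ee eqxx in e0.
  by rewrite -(incr_upd es) a_incr mulr0.
have aE : a = structm c.
  by apply/eqP; rewrite -subr_eq0; apply/eqP/symbol_inj0; rewrite symbolB sa subrr.
clearbody c; move: ga; rewrite sa aE (alg_homC hg) => gc.
have [->|c0] := eqVneq c 0; first by rewrite rmorph0 symbol0.
by case/eqP: B1; rewrite -(rmorph1 (@structm F B)) -(mulfV c0) rmorphM /= gc mul0r.
Qed.

End WeylSimplicity.

(** * Reduction of injectivity to t = 1 *)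

Section SpecializationAtOne.
Context (F : fieldType) (n : nat).
Hypothesis char0 : [pchar F] =i pred0.
Local Notation L := (laurent F).
Local Notation q1 := (oner_neq0 F).
Local Notation ev := (laurent_eval q1).
Local Notation A := (weyl_t F n).
Local Notation tq := (laurent_t F - laurent_const 1).
Local Notation spec := (specialize (n := n) q1).

(** Otherwise t - 1 could be divided out forever, and the coefficients of the symbol of [a] would be
    divisible by all its powers. *)
Lemma weyl_t_divide (a : A) : a <> 0 ->
  exists k b, a = structm (tq ^+ k) * b /\ spec b <> 0.
Proof.
move=> a0; apply: contrapT => nk; apply/a0/symbol_inj0/funext => e.
apply: (laurent_tq_separated q1) => k.
suff [b ->] : exists b, a = structm (tq ^+ k) * b.
  by exists (symbol b e); rewrite symbolZ.
elim: k => [|k [b ab]]; first by exists a; rewrite expr0 rmorph1 mul1r.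
have [b' bb] : exists b', b = structm tq * b'.
  by apply: (specialize_ker (q_neq0 := q1)); apply: contrapT => sb; apply: nk; exists k, b.
by exists b'; rewrite ab bb exprSr rmorphM mulrA.
Qed.

Lemma weyl_t_torsion_free (a : A) : structm tq * a = 0 -> a = 0.
Proof.
move=> ta; apply/symbol_inj0/funext => e; apply/eqP.
apply/eqP/(@laurent_tq_regular F 1).
by rewrite -[LHS](vscaleE tq) -symbolZ ta symbol0.
Qed.

Section Factor.
Context (W : pzAlgType L) (h : A -> W).
Hypotheses (hh : alg_hom h) (tqW : structm tq = 0 :> W).
Local Notation W0 := (restrict_scalars (@laurent_const F) W).

(** [c] differs from its value at 1 by a multiple of t - 1, which is zero in [W]. *)
Lemma structm_eval c : structm (laurent_const (ev c)) = structm c :> W.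
Proof.
have [|v] := @laurent_eval_ker F 1 q1 (c - laurent_const (ev c)).
  by rewrite rmorphB /= laurent_eval_const subrr.
move=> /(congr1 (@structm L W)); rewrite rmorphM /= tqW mul0r rmorphB /=.
by move=> /eqP; rewrite subr_eq0 => /eqP.
Qed.

Let X (i : 'I_n) : W0 := h (weyl_x _ i).
Let D (i : 'I_n) : W0 := h (weyl_d _ i).

Lemma factor_dx i j : D i * X j = structm (1 ^+ (i == j)) * X j * D i + (i == j)%:R.
Proof.
have := congr1 h (weyl_dx (laurent_t F) i j).
rewrite (alg_homM hh) (alg_homD hh) !(alg_homM hh) (alg_homC hh) -structm_eval.
rewrite rmorphXn /= laurent_eval_t => e; rewrite [LHS]e; congr (_ + _).
by case: (i == j); [exact: alg_hom1 hh|exact: alg_hom0 hh].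
Qed.

Lemma factor_xx i j : X i * X j = X j * X i.
Proof. by have := congr1 h (weyl_xx (laurent_t F) i j); rewrite !(alg_homM hh). Qed.
Lemma factor_dd i j : D i * D j = D j * D i.
Proof. by have := congr1 h (weyl_dd (laurent_t F) i j); rewrite !(alg_homM hh). Qed.

Definition factor : qweyl (1 : F) n -> W0 := weyl_lift X D.

Lemma factor_hom : alg_hom factor.
Proof. exact: weyl_lift_hom factor_dx factor_xx factor_dd. Qed.
Lemma factor_x i : factor (weyl_x 1 i) = X i.
Proof. exact: weyl_lift_x factor_dx factor_xx factor_dd i. Qed.
Lemma factor_d i : factor (weyl_d 1 i) = D i.
Proof. exact: weyl_lift_d factor_dx factor_xx factor_dd i. Qed.

Lemma factor_specialize a : factor (spec a) = h a.
Proof.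
have H := specialize_hom n q1; elim/weyl_ind: a => [a b ha hb|c|i a ha|i a ha].
- by rewrite (alg_homD H) (alg_homD factor_hom) ha hb (alg_homD hh).
- rewrite (alg_homC H) -[structm c]/(@structm F (qweyl 1 n) (ev c)) (alg_homC factor_hom).
  by rewrite (alg_homC hh); exact: structm_eval.
- by rewrite (alg_homM H) (alg_homM factor_hom) ha specialize_x factor_x (alg_homM hh).
- by rewrite (alg_homM H) (alg_homM factor_hom) ha specialize_d factor_d (alg_homM hh).
Qed.

Lemma specialize_ker_hom a : 1 != 0 :> W -> h a = 0 -> spec a = 0.
Proof.
move=> W1 ha; apply: (@weyl_simple F n char0 W0 factor W1 factor_hom (spec a)).
by rewrite factor_specialize.
Qed.

End Factor.

(** [w] plays the role of reduction modulo t - 1. The target [B] is left general so as to cover both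
    the algebra and its localization. *)
Lemma weyl_t_hom_inj (B W : pzAlgType L) (w : B -> W) (h : A -> B) :
    alg_hom w -> 1 != 0 :> W -> structm tq = 0 :> W ->
    (forall b : B, structm tq * b = 0 -> b = 0) -> alg_hom h ->
  forall a, h a = 0 -> a = 0.
Proof.
move=> hw W1 tqW tfree hh a ha; apply: contrapT => /weyl_t_divide[k [b [ab]]]; apply.
apply: (specialize_ker_hom (alg_hom_comp hw hh) tqW W1).
suff hb : h b = 0 by rewrite /= hb (alg_hom0 hw).
move: ha; rewrite ab (alg_homM hh) (alg_homC hh) {ab}.
(* The factors t - 1 are cancelled one at a time, as [B] has no torsion. *)
elim: k (h b) => [|k IHk] z; first by rewrite expr0 rmorph1 mul1r.
by rewrite exprS rmorphM -mulrA => /tfree; exact: IHk.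
Qed.

Lemma specialize_tq : structm tq = 0 :> restrict_scalars ev (qweyl (1 : F) n).
Proof.
have H := specialize_hom n q1.
by rewrite -(alg_homC H) (specialize_rel q1).
Qed.

Lemma weyl_t_endo_inj (h : A -> A) : alg_endo L A h -> injective h.
Proof.
move=> hh a b hab; apply/eqP; rewrite -subr_eq0; apply/eqP.
apply: (weyl_t_hom_inj (specialize_hom n q1) _ specialize_tq _ hh).
- exact: weyl_oner_neq0.
- exact: weyl_t_torsion_free.
- by rewrite (alg_homB hh) hab subrr.
Qed.

End SpecializationAtOne.

(** * The localized algebra and the theorem *)

Section OreLift.
Context (R : comPzRingType) (A : pzAlgType R) (f : ore_elt A).
Context (W : pzAlgType R) (s : A -> W).
Hypotheses (hs : alg_hom s) (sf : s (oelt f) = 1) (stau : forall a, s (otau f a) = s a).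

(** The fraction a f^-k goes to s(a), because s(f) = 1. Multiplicativity rests on [stau], since
    moving f^-k past b applies powers of tau to b. *)
Definition ore_lift (x : ore_loc f) : W := s (repr x).1.

Lemma ore_liftE a k : ore_lift (ore_frac f a k) = s a.
Proof.
have sX m : s (oelt f ^+ m) = 1 by rewrite (alg_homX hs) sf expr1n.
have /ore_fracP[m] := ore_frac_repr f a k.
by move=> /(congr1 s); rewrite !(alg_homM hs) !sX !mulr1.
Qed.

Lemma ore_lift_hom : alg_hom ore_lift.
Proof.
have siter k a : s (iter k (otau f) a) = s a by elim: k => //= k IHk; rewrite stau.
split=> [x y||c].
- have [a [b [k [-> ->]]]] := ore_frac_common x y.
  by rewrite ore_fracN ore_fracD !ore_liftE (alg_homB hs).
- split=> [|]; first by rewrite ore_liftE (alg_hom1 hs).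
  elim/ore_frac_ind=> a k; elim/ore_frac_ind=> b l.
  by rewrite ore_fracM !ore_liftE (alg_homM hs) siter.
- by rewrite ore_liftE (alg_homC hs).
Qed.

End OreLift.

Section LocalizedWeyl.
Context (F : fieldType) (n : nat).
Hypothesis char0 : [pchar F] =i pred0.
Local Notation L := (laurent F).
Local Notation q1 := (oner_neq0 F).
Local Notation A := (weyl_t F n).
Local Notation Af := (weyl_tf F n).
Local Notation tq := (laurent_t F - laurent_const 1).
Local Notation spec := (specialize (n := n) q1).
Local Notation f := (weyl_ore n (laurent_tVK F)).
Local Notation hspec := (specialize_hom n q1).

Lemma specialize_f : spec (oelt f) = 1.
Proof.
rewrite (alg_hom_prod hspec) big1 // => i _.
rewrite (alg_homB hspec) !(alg_homM hspec) specialize_x specialize_d.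
rewrite -[X in X - _]/(weyl_d 1 i * weyl_x 1 i) weyl_dx eqxx expr1 rmorph1 mul1r.
by rewrite addrAC subrr add0r.
Qed.

(** tau rescales the generators by t and its inverse, which both become 1. *)
Lemma specialize_tau a : spec (otau f a) = spec a.
Proof.
have ev1 c : c * laurent_t F = 1 -> 
   structm c = 1 :> restrict_scalars (laurent_eval q1) (qweyl (1 : F) n).
  move=> ct; rewrite -[LHS]/(@structm F (qweyl 1 n) (laurent_eval q1 c)).
  have := congr1 (laurent_eval q1) ct; rewrite rmorphM rmorph1 /= laurent_eval_t mulr1 => ->.
  by rewrite rmorph1.
apply: (@weyl_hom_ext _ _ _ _ (spec \o otau f) spec) => [||i|i].
- exact: alg_hom_comp hspec (otau_hom f).
- exact: hspec.
- rewrite /= weyl_tau_x ?laurent_tVK // (alg_homM hspec) (alg_homC hspec) ev1 ?mul1r //.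
  by rewrite mulrC laurent_tVK.
- rewrite /= weyl_tau_d ?laurent_tVK // (alg_homM hspec) (alg_homC hspec).
  have := specialize_tq F n; rewrite rmorphB /= !rmorph1 => /eqP; rewrite subr_eq0 => /eqP ->.
  by rewrite mul1r.
Qed.

(** Divide a nonzero [a] by powers of t - 1 to get b nonzero at t = 1. Then b f^k = 0 as well, and
    at t = 1, where f is 1, this makes b vanish. *)
Lemma weyl_f_regular (a : A) k : a * oelt f ^+ k = 0 -> a = 0.
Proof.
move=> af; apply: contrapT => /weyl_t_divide[l [b [ab]]]; apply.
suff bf : b * oelt f ^+ k = 0.
  have := alg_homM hspec b (oelt f ^+ k).
  by rewrite bf (alg_hom0 hspec) (alg_homX hspec) specialize_f expr1n mulr1.
move: af; rewrite {}ab; elim: l => [|l IHl]; first by rewrite expr0 rmorph1 mul1r.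
by rewrite exprS rmorphM -!mulrA => /weyl_t_torsion_free; rewrite mulrA.
Qed.

Lemma weyl_tf_torsion_free (x : Af) : structm tq * x = 0 -> x = 0.
Proof.
elim/ore_frac_ind: x => a k; rewrite [structm tq * _]ore_fracM => /ore_fracP[m].
rewrite mul0r -mulrA => /weyl_t_torsion_free/weyl_f_regular /= ->.
exact: ore_frac0.
Qed.

Lemma weyl_tf_endo_inj (h : Af -> Af) : alg_endo L Af h -> injective h.
Proof.
move=> hh x y hxy; apply/eqP; rewrite -subr_eq0; apply/eqP.
have : h (x - y) = 0 by rewrite (alg_homB hh) hxy subrr.
elim/ore_frac_ind: (x - y) => a k hak.
have hw := ore_lift_hom hspec specialize_f specialize_tau.
(* [h] is restricted to the image of the unlocalized algebra. *)
have hi := alg_hom_comp hh (ore_inj_hom f).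
suff -> : a = 0 by exact: ore_frac0.
apply: (weyl_t_hom_inj char0 hw _ (specialize_tq F n) weyl_tf_torsion_free hi).
  exact: weyl_oner_neq0.
(* The numerator is the fraction times f^k, so [h] kills it too. *)
by rewrite /= -(ore_fracK f a k) (alg_homM hh) hak mul0r.
Qed.

End LocalizedWeyl.

(** * Transport of endomorphisms to the quotient by t - q *)

Section Transport.
Context (F : fieldType) (n : nat) (q : F) (q_neq0 : q != 0).
Local Notation to := (@weyl_q_to F n q q_neq0).
Local Notation of_ := (@weyl_q_of F n q).

Definition transport (h : qweyl q n -> qweyl q n) : weyl_q F n q -> weyl_q F n q :=
  of_ \o h \o to.

Lemma transport_endo h : alg_hom h -> alg_endo F (weyl_q F n q) (transport h).
Proof.
move=> hh; apply: alg_hom_comp (weyl_q_to_hom n q_neq0).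
exact: alg_hom_comp (weyl_q_of_hom n q) hh.
Qed.

Lemma transport_inj h : injective h <-> injective (transport h).
Proof.
have K := @weyl_q_ofK F n q q_neq0; have K' := @weyl_q_toK F n q q_neq0.
split=> hi a b e; first by apply/(can_inj K')/hi/(can_inj K).
by apply/(can_inj K)/hi; rewrite /transport /= !K e.
Qed.

Lemma transport_surj h : surjective (transport h) -> surjective h.
Proof.
have K := @weyl_q_ofK F n q q_neq0.
by move=> hs b; have [a ab] := hs (of_ b); exists (to a); apply: (can_inj K).
Qed.

End Transport.

(* The field of complex numbers is K[i], K being the field of real numbers. *)
Theorem proposition2p1 (K : realType) (n : nat) (q : K[i])
    (hn : (0 < n)%N) (q_neq0 : q != 0) (q_neq1 : q != 1) :
  (* (i) *)
  ((exists h : weyl_t K[i] n -> weyl_t K[i] n,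
      [/\ alg_endo (laurent K[i]) (weyl_t K[i] n) h,
          injective h & ~ surjective h])
   /\
   (exists h : weyl_q K[i] n q -> weyl_q K[i] n q,
      [/\ alg_endo K[i] (weyl_q K[i] n q) h, injective h & ~ surjective h]))
  /\
  (* (ii) *)
  (exists h : weyl_q K[i] n q -> weyl_q K[i] n q,
      [/\ alg_endo K[i] (weyl_q K[i] n q) h, ~ injective h & ~ surjective h])
  /\
  (* (iii) *)
  ((forall h : weyl_t K[i] n -> weyl_t K[i] n,
      alg_endo (laurent K[i]) (weyl_t K[i] n) h -> injective h)
   /\
   (forall h : weyl_tf K[i] n -> weyl_tf K[i] n,
      alg_endo (laurent K[i]) (weyl_tf K[i] n) h -> injective h)).
Proof.
pose i0 : 'I_n := Ordinal hn; have char0 := Num.Theory.pchar_num K[i].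
split; [split|split; [|split]].
- exists (@twist _ (laurent_t K[i]) n i0); split; [exact: twist_hom|exact: twist_inj|].
  (* Evaluation at q turns the two-dimensional representation into one of the algebra over Laurent
     polynomials. *)
  by apply: (@twist_not_surj _ _ (laurent_eval q_neq0)); rewrite /= laurent_eval_t.
- exists (transport q_neq0 (@twist _ q n i0)); split.
  + by apply: transport_endo; exact: twist_hom.
  + by apply/transport_inj; exact: twist_inj.
  + by move=> /transport_surj; exact: (@twist_not_surj _ _ idfun).
- exists (transport q_neq0 (@collapse _ q n)); split.
  + by apply: transport_endo; exact: collapse_hom.
  + by move=> /transport_inj; exact: collapse_not_inj.
  + by move=> /transport_surj; exact: collapse_not_surj.
- exact: weyl_t_endo_inj.
- exact: weyl_tf_endo_inj.
Qed.
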